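(* Assume: (1) $b_n,d_n,p_{n,k}$ are measurable on $A$; there is $\bar b>0$ with $b_n(a)\le \bar b\,n$ for all $n\in\mathbb{Z}_+,a\in A$; there is a sequence $(\bar d_n)_{n\in\mathbb{Z}_+}$ in $\mathbb{R}_+$ with $d_n(a)\le \bar d_n$ for all $n\in\mathbb{Z}_+,a\in A$; there is $M>0$ with $\sum_{k\ge1}k\,p_{n,k}(a)\le M$ for all $n\in\mathbb{Z}_+,a\in A$. (2) There are $\epsilon>0$ and $\underline d>0$ with $d_n(a)\ge\underline d\,n^{1+\epsilon}$ for all $n\in\mathbb{Z}_+,a\in A$; and for all $y,z\in\mathbb{N}$, $\inf_{\alpha\in\mathcal{A}_M}\mathbb{P}(X^{y,\alpha}_1=z)>0$. Then for every Markov control $\alpha\in\mathcal{A}_M$ there exists a unique quasi-stationary distribution $\pi^\alpha$ on $\mathbb{N}$ for the process $X^\alpha$, and there exist constants $C,\gamma>0$ (not depending on $\alpha$) such that for all $\alpha\in\mathcal{A}_M$ and all $x\in\mathbb{N}$, $$\left\|\mathbb{P}(X^{x,\alpha}_t\in\cdot\mid t<\tau^{x,\alpha})-\pi^\alpha\right\|_{TV}\le Ce^{-\gamma t},\qquad\forall t\ge0,$$ where $\|\cdot\|_{TV}$ is the total variation norm and $\tau^{x,\alpha}=\inf\{s\ge0: X^{x,\alpha}_s=0\}$.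
   Context: $\mathbb{Z}_+=\{0,1,2,\dots\}$, $\mathbb{N}=\{1,2,\dots\}$. $A$ is a Polish space (control space). For $n\in\mathbb{Z}_+$, $k\in\mathbb{N}$, $b_n,d_n:A\to\mathbb{R}_+$ and $p_{n,k}:A\to[0,1]$ are functions with $\sum_{k\ge1}p_{n,k}(a)=1$ for all $n,a$, and $b_0\equiv d_0\equiv0$. A Markov control is a sequence $\alpha=(\alpha_n)_{n\in\mathbb{Z}_+}$ with values in $A$; $\mathcal{A}_M$ is the set of Markov controls. For $\alpha\in\mathcal{A}_M$ and $x\in\mathbb{Z}_+$, $X^{x,\alpha}$ is the continuous-time Markov chain on $\mathbb{Z}_+$ started at $x$ with transition rates $b_n(\alpha_n)p_{n,k}(\alpha_n)$ from $n$ to $n+k$ ($n,k\ge1$), $d_n(\alpha_n)$ from $n$ to $n-1$ ($n\ge1$), and no other transitions (so $0$ is absorbing); it is non-explosive under assumption (1). $X^\alpha$ denotes this chain with generic initial condition and $\tau^\alpha$ its hitting time of $0$. A probability measure $\pi$ on $\mathbb{N}$ is a quasi-stationary distribution for $X^\alpha$ if $\mathbb{P}_\pi(X^\alpha_t\in\cdot\mid t<\tau^\alpha)=\pi$ for all $t\ge0$, where $\mathbb{P}_\pi$ means $X^\alpha_0\sim\pi$. *)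

(* Defs.v *)
From HB Require Import structures.
From mathcomp Require Import all_boot all_order all_algebra.
From mathcomp Require Import all_classical all_reals all_analysis.

Set Implicit Arguments.
Unset Strict Implicit.
Unset Printing Implicit Defensive.

Import Order.TTheory GRing.Theory Num.Theory.
Import numFieldNormedType.Exports.

Local Open Scope classical_set_scope.
Local Open Scope ring_scope.

Definition polish (R : realType) (A : topologicalType) : Prop :=
  (exists2 S : set A, countable S & dense S) /\
  exists M : metricType R,
    (forall F : set_system M,
       ProperFilter F -> cauchy F -> exists x : M, F --> x) /\
    exists (f : A -> M) (g : M -> A),
      [/\ cancel f g, cancel g f, continuous f & continuous g].

Definition borel_fun (R : realType) (A : topologicalType) (f : A -> R) : Prop :=
  forall B : set R, measurable B -> <<s @open A >> (f @^-1` B).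

(* Total mass of the variation of the signed measure m. Normalisation: for
   probability measures mu and nu, tv_norm (mu - nu) is twice the supremum of
   `|mu B - nu B| over measurable B. *)
Definition tv_norm (R : realType) (d : measure_display) (T : measurableType d)
    (m : set T -> \bar R) : \bar R :=
  ereal_sup [set v | exists (n : nat) (E : 'I_n -> set T),
    [/\ forall i, measurable (E i),
        trivIset [set: 'I_n] E,
        \bigcup_i E i = [set: T] &
        v = (\sum_(i < n) `|m (E i)|)%E]].

(* Processes indexed by the nonnegative reals; the values at negative times are
   irrelevant and never used. *)
Record nat_process (R : realType) := NatProcess {
  np_display : measure_display;
  np_space : measurableType np_display;
  np_prob : probability np_space R;
  np_val : R -> np_space -> nat;
  np_measurable : forall t, 0 <= t -> measurable_fun [set: np_space] (np_val t)
}.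
Arguments np_val {R} X t w : rename.

Section ContinuousTimeMarkovChain.
Variable R : realType.

Definition cadlag (x : R -> nat) : Prop :=
  (forall t, 0 <= t -> \forall s \near t^'+, x s = x t) /\
  (forall t, 0 < t -> exists n : nat, \forall s \near t^'-, x s = n).

Definition transition_function (P : R -> nat -> nat -> R) : Prop :=
  [/\ forall t i j, 0 <= t -> 0 <= P t i j,
      forall t i, 0 <= t -> (\sum_(j <oo) (P t i j)%:E = 1)%E,
      forall i j, P 0 i j = (i == j)%:R &
      forall s t i j, 0 <= s -> 0 <= t ->
        ((P (s + t) i j)%:E = \sum_(k <oo) (P s i k * P t k j)%:E)%E].

Definition has_rates (q : nat -> nat -> R) (P : R -> nat -> nat -> R) : Prop :=
  forall i j, (P h i j - (i == j)%:R) / h @[h --> 0^'+] --> q i j.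

(* P(X_{t_{n+1}} = i_{n+1} | X_{t_0} = i_0, ..., X_{t_n} = i_n)
     = P_{t_{n+1} - t_n}(i_n, i_{n+1}), cleared of denominators. *)
Definition markov (P : R -> nat -> nat -> R) (X : nat_process R) : Prop :=
  forall (n : nat) (t : nat -> R) (i : nat -> nat),
    0 <= t 0%N -> (forall k, t k <= t k.+1) ->
    (np_prob X (\bigcap_(k in [set k | (k <= n.+1)%N])
                  [set w | np_val X (t k) w = i k])
     = np_prob X (\bigcap_(k in [set k | (k <= n)%N])
                  [set w | np_val X (t k) w = i k])
       * (P (t n.+1 - t n) (i n) (i n.+1))%:E)%E.

(* The chain takes its values in nat at all times, and its paths have finitely
   many jumps on bounded time intervals: it does not explode. *)
Definition is_ctmc (q : nat -> nat -> R) (mu : probability nat R)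
    (X : nat_process R) : Prop :=
  [/\ forall w : np_space X, cadlag (fun t => np_val X t w),
      forall B : set nat, np_prob X (np_val X 0 @^-1` B) = mu B &
      exists P, [/\ transition_function P, has_rates q P & markov P X]].

Definition hitting_time0 (X : nat_process R) (w : np_space X) : \bar R :=
  ereal_inf (EFin @` [set s : R | 0 <= s /\ np_val X s w = 0%N]).

Definition survival (X : nat_process R) (t : R) : set (np_space X) :=
  [set w | (t%:E < hitting_time0 w)%E].
Arguments survival X t : clear implicits.

(* P(X_t \in B | t < tau); identically 0, hence not a probability measure, when
   P(t < tau) = 0. *)
Definition cond_law (X : nat_process R) (t : R) (B : set nat) : \bar R :=
  (np_prob X (np_val X t @^-1` B `&` survival X t)
   * (fine (np_prob X (survival X t)))^-1%:E)%E.

(* X mu is the process started from the initial law mu; measures on the positive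
   integers are measures on nat that do not charge 0. *)
Definition is_qsd (X : probability nat R -> nat_process R)
    (pi : probability nat R) : Prop :=
  pi [set 0%N] = 0%E /\
  forall t, 0 <= t -> forall B : set nat, cond_law (X pi) t B = pi B.

End ContinuousTimeMarkovChain.

(* p n k is only meaningful for k >= 1. The diagonal is minus the total jump rate
   because the p n k, k >= 1, sum to 1; row 0 vanishes when b 0 = d 0 = 0. *)
Definition bd_rate (R : realType) (A : Type) (b d : nat -> A -> R)
    (p : nat -> nat -> A -> R) (alpha : nat -> A) (i j : nat) : R :=
  if (i < j)%N then b i (alpha i) * p i (j - i)%N (alpha i)
  else if i == j.+1 then d i (alpha i)
  else if i == j then - (b i (alpha i) + d i (alpha i))
  else 0.

(* Main.v *)
Require Import Defs.
From HB Require Import structures.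
From mathcomp Require Import all_boot all_order all_algebra.
From mathcomp Require Import all_classical all_reals all_analysis.
From mathcomp Require Import ring lra.

Set Implicit Arguments.
Unset Strict Implicit.
Unset Printing Implicit Defensive.

Import Order.TTheory GRing.Theory Num.Theory.
Import numFieldNormedType.Exports.

Local Open Scope classical_set_scope.
Local Open Scope ring_scope.

(* The theorem rests on two estimates for the transition function P, uniform in
   the control: a minorization P_{t0}(x, 1) >= c1 for all x >= 1, and a
   comparison P_x(t < tau) <= K P_1(t < tau) for all x and t. Both follow from a
   maximum principle for the backward equation, P being compared with sub- and
   supersolutions built from the bounded function W n = 2 - (n + 1)^{-eps/2}.
   As deaths are superlinear, the drift of W is at most - lam W outside a finite
   set; inside that set the irreducibility at time 1 is used. The same maximum
   principle shows that the rates determine P, so that all initial laws share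
   one transition function.
   If f takes values in [0, 1] and S_t is the semigroup of the chain killed at 0,
   the two estimates make the oscillation of S_t f / S_t 1 contract by the factor
   1 - c1 / K every t0. Hence the conditioned laws started from 1 are Cauchy in
   total variation; their limit is the quasi-stationary distribution, and every
   conditioned law approaches it at the same geometric rate. *)

(** * Expectations under mass functions on nat *)

(** Why the exponent eps / 2: put a = eps / 2. A death lowers W by order n^{-1-a} and has rate at
    least of order n^{1+eps}, so deaths give a negative drift of order n^a, which outgrows every
    constant. A birth of size k raises W by at most a k / (n + 1) and births have rate at most
    [bbar] n, so the bound on the mean of k keeps their contribution bounded. Hence lam can be
    prescribed before the finite set is. It is taken larger than the exit rate from 1, because the
    supersolution carries the factor P_1(t < tau), which decays at most at that exit rate, and the
    drift of W has to make up for this decay. The obstacle is how little is given about P: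
    derivatives at time 0, entry by entry. There is no Kolmogorov equation at positive times and no
    interchange of rates with infinite sums. The backward equation therefore appears only as
    inequalities between finite sums, with an error, for small steps back in time, and the maximum
    principle is stated for functions satisfying such inequalities. *)

Lemma cvg_sum_nat (R : realType) (T : Type) (F : set_system T) {FF : Filter F}
    (f : nat -> T -> R) (a : nat -> R) K :
  (forall k, f k x @[x --> F] --> a k) ->
  \sum_(0 <= k < K) f k x @[x --> F] --> \sum_(0 <= k < K) a k.
Proof.
move=> fa; elim: K => [|K IH].
  by under eq_fun do rewrite big_geq//; rewrite big_geq//; exact: cvg_cst.
under eq_fun do rewrite big_nat_recr//=.
by rewrite big_nat_recr//=; exact: cvgD.
Qed.

Section Expectation.
Variable R : realType.
Implicit Types (p f g : nat -> R).

Definition mass p : Prop :=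
  (forall k, 0 <= p k) /\ (\sum_(k <oo) (p k)%:E = 1)%E.

(** A real limit, so that the values are accessible to real arithmetic. It is meaningful when the
    series converges, as it does for bounded [f]. *)
Definition ev p f : R := limn (series (fun k => p k * f k)).

Lemma mass_series p : mass p -> series p @ \oo --> (1 : R).
Proof.
move=> [p0 p1]; have cp : cvgn (series p).
  by apply: nnseries_is_cvg => //; rewrite p1 ltry.
suff <- : limn (series p) = 1 by [].
apply: EFin_inj; rewrite -EFin_lim// -p1; congr (limn _).
by apply/funext => n /=; rewrite sumEFin.
Qed.

Lemma ev_cvg p f C : mass p -> (forall k, `|f k| <= C) ->
  cvgn (series (fun k => p k * f k)).
Proof.
move=> mp fC; have [p0 _] := mp.
have cCp : cvgn (series (C *: p)).
  apply: (@is_cvg_seriesZ _ p C); apply/cvg_ex; exists 1; exact: mass_series.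
apply: normed_cvg; apply: series_le_cvg cCp.
- by move=> n /=.
- by move=> n /=; rewrite mulr_ge0//; apply: le_trans (fC n).
- move=> n /=; rewrite normrM (ger0_norm (p0 n)) mulrC.
  by apply: ler_wpM2r => //; exact: fC.
Qed.

Lemma ev_lin p f g a b C D : mass p ->
  (forall k, `|f k| <= C) -> (forall k, `|g k| <= D) ->
  ev p (fun k => a * f k + b * g k) = a * ev p f + b * ev p g.
Proof.
move=> mp fC gD; have cf := ev_cvg mp fC; have cg := ev_cvg mp gD.
rewrite /ev.
have -> : (fun k => p k * (a * f k + b * g k)) =
          (a *: (fun k => p k * f k)) + (b *: (fun k => p k * g k)).
  by apply/funext => k; rewrite !fctE /GRing.scale /=; ring.
have caf := @is_cvg_seriesZ _ _ a cf; have cbg := @is_cvg_seriesZ _ _ b cg.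
by rewrite (lim_seriesD caf cbg) (lim_seriesZ a cf) (lim_seriesZ b cg).
Qed.

Lemma ev_le p f g C D : mass p ->
  (forall k, `|f k| <= C) -> (forall k, `|g k| <= D) ->
  (forall k, f k <= g k) -> ev p f <= ev p g.
Proof.
move=> mp fC gD fg; apply: lim_series_le.
- exact: ev_cvg mp fC.
- exact: ev_cvg mp gD.
- by move=> k; rewrite ler_wpM2l//; case: mp.
Qed.

Lemma ev_cst p c : mass p -> ev p (fun=> c) = c.
Proof.
move=> mp; rewrite /ev.
have -> : (fun k => p k * c) = c *: p.
  by apply/funext => k; rewrite mulrC.
have cp := mass_series mp.
rewrite lim_seriesZ; last by apply/cvg_ex; exists 1.
by rewrite (cvg_lim _ cp)// /GRing.scale /= mulr1.
Qed.

Lemma norm01 f : (forall k, 0 <= f k <= 1) -> forall k, `|f k| <= 1.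
Proof. by move=> f01 k; have /andP[? ?] := f01 k; rewrite ger0_norm. Qed.

Lemma ev01 p f : mass p -> (forall k, 0 <= f k <= 1) -> 0 <= ev p f <= 1.
Proof.
move=> mp f01; have nf := norm01 f01; apply/andP; split.
  rewrite -[leLHS](ev_cst 0 mp); apply: (ev_le (C := 0) mp _ nf).
    by move=> _; rewrite normr0.
  by move=> k; case/andP: (f01 k).
rewrite -[leRHS](ev_cst 1 mp); apply: (ev_le (D := 1) mp nf).
  by move=> _; rewrite normr1.
by move=> k; case/andP: (f01 k).
Qed.

Lemma evE p f C : mass p -> (forall k, 0 <= f k <= C) ->
  (ev p f)%:E = (\sum_(k <oo) (p k * f k)%:E)%E.
Proof.
move=> mp f01; rewrite /ev -EFin_lim; last first.
  apply: (@ev_cvg _ _ C) => // k; have /andP[? ?] := f01 k.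
  by rewrite ger0_norm.
by congr (limn _); apply/funext => n /=; rewrite sumEFin.
Qed.

(** Dropping the tail gives the lower bound; the upper bound is the lower bound for 1 - f. *)
Lemma ev_trunc p f K : mass p -> (forall k, 0 <= f k <= 1) ->
  \sum_(0 <= k < K) p k * f k <= ev p f <=
  \sum_(0 <= k < K) p k * f k + (1 - \sum_(0 <= k < K) p k).
Proof.
move=> mp f01; have [p0 _] := mp.
have low g : (forall k, 0 <= g k <= 1) -> \sum_(0 <= k < K) p k * g k <= ev p g.
  move=> g01; rewrite -lee_fin (evE mp g01) -sumEFin.
  apply: nneseries_lim_ge => n _ _; rewrite lee_fin mulr_ge0//.
  by case/andP: (g01 n).
rewrite low//=.
have h01 k : 0 <= 1 - f k <= 1 by have := f01 k; lra.
have := low _ h01.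
have -> : ev p (fun k => 1 - f k) = 1 - ev p f.
  have := @ev_lin p (fun=> 1) f 1 (-1) 1 1 mp.
  rewrite (ev_cst _ mp) mul1r mulN1r => <-.
  - by congr (ev p _); apply/funext => k; ring.
  - by move=> k; rewrite normr1.
  - exact: norm01.
have -> : \sum_(0 <= k < K) p k * (1 - f k) =
    \sum_(0 <= k < K) p k - \sum_(0 <= k < K) p k * f k.
  by rewrite -sumrB; apply: eq_bigr => k _; ring.
lra.
Qed.

Lemma ev_ge_term p f j : mass p -> (forall k, 0 <= f k <= 1) ->
  p j * f j <= ev p f.
Proof.
move=> mp f01; have /andP[+ _] := ev_trunc j.+1 mp f01.
rewrite big_nat_recr//=; apply: le_trans; rewrite lerDr sumr_ge0// => k _.
by rewrite mulr_ge0//; [case: mp | case/andP: (f01 k)].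
Qed.

Lemma ev_le_term p f j : mass p -> (forall k, 0 <= f k <= 1) ->
  ev p f <= p j * f j + (1 - p j).
Proof.
move=> mp f01; have /andP[_] := ev_trunc j.+1 mp f01.
rewrite !big_nat_recr//=; move=> /le_trans; apply.
have : \sum_(0 <= k < j) p k * f k <= \sum_(0 <= k < j) p k.
  apply: ler_sum => k _; rewrite ler_piMr//; first by case: mp.
  by case/andP: (f01 k).
lra.
Qed.

Lemma ev_delta p (j : nat) : mass p -> ev p (fun k => (k == j)%:R) = p j.
Proof.
move=> mp; apply/eqP; rewrite eq_le.
have d01 (k : nat) : 0 <= ((k == j)%:R : R) <= 1 by case: (k == j); rewrite ?lexx ?ler01.
have := ev_ge_term j mp d01; rewrite eqxx mulr1 => ->; rewrite andbT.
have dE K : \sum_(0 <= k < K) p k * (k == j)%:R <= p j.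
  rewrite big_mkord (eq_bigr (fun k : 'I_K => if (k : nat) == j then p j else 0)).
    rewrite -big_mkcond /=; case: (ltnP j K) => jK.
      by rewrite (big_pred1 (Ordinal jK)).
    rewrite big_pred0; first by case: mp.
    by move=> k; apply/negbTE; rewrite neq_ltn (leq_trans (ltn_ord k) jK).
  by move=> k _; case: eqVneq => [->|]; rewrite ?mulr1 ?mulr0.
apply: limr_le; first by apply: (@ev_cvg _ _ 1) => //; exact: norm01.
by apply: nearW => K; rewrite seriesEnat /=; exact: dE.
Qed.

(** Tonelli: all terms are nonnegative, so the double series may be summed in either order in the
    extended reals. *)
Lemma ev_mix p (r : nat -> nat -> R) : mass p -> (forall k, mass (r k)) ->
  let m j := ev p (fun k => r k j) in
  mass m /\
  forall f, (forall k, 0 <= f k <= 1) -> ev m f = ev p (fun k => ev (r k) f).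
Proof.
move=> mp mr m; have [p0 p1] := mp.
have r0 k j : 0 <= r k j by case: (mr k).
have r01 k j : 0 <= r k j <= 1.
  rewrite -(ev_delta j (mr k)); apply: ev01 => // l.
  by case: (l == j); rewrite ?lexx ?ler01.
have swap f : (forall k, 0 <= f k <= 1) ->
    (\sum_(j <oo) (m j * f j)%:E = (ev p (fun k => ev (r k) f))%:E)%E.
  move=> f01; have f0 k : 0 <= f k by case/andP: (f01 k).
  rewrite (evE mp (C := 1)); last by move=> k; exact: ev01.
  transitivity (\sum_(j <oo) \sum_(k <oo) (p k * r k j * f j)%:E)%E.
    apply: eq_eseriesr => j _; rewrite EFinM (evE mp (fun k => r01 k j)).
    rewrite muleC -nneseriesZl; last by move=> k _; rewrite lee_fin mulr_ge0.
    by apply: eq_eseriesr => k _; rewrite -EFinM mulrC.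
  rewrite nneseries_interchange; last by move=> k j; rewrite lee_fin !mulr_ge0.
  apply: eq_eseriesr => k _; rewrite EFinM (evE (mr k) f01).
  rewrite -nneseriesZl; last by move=> j _; rewrite lee_fin mulr_ge0.
  by apply: eq_eseriesr => j _; rewrite -EFinM mulrA.
have mm : mass m.
  split; first by move=> j; case/andP: (ev01 mp (fun k => r01 k j)).
  have := swap (fun=> 1); under eq_eseriesr do rewrite mulr1.
  move=> ->; last by move=> _; rewrite ler01 lexx.
  rewrite (_ : (fun k => _) = fun=> 1) ?ev_cst//.
  by apply/funext => k; rewrite ev_cst.
by split=> // f f01; apply: EFin_inj; rewrite (evE mm f01) swap.
Qed.

(** Conditioning: for [w] the indicator of an event of probability [z], [m] is [p] conditioned on
    that event. *)
Lemma ev_scale p (w : nat -> R) z : mass p -> (forall k, 0 <= w k <= 1) ->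
  0 < z -> ev p w = z ->
  let m j := p j * w j / z in
  mass m /\ forall f, (forall k, 0 <= f k <= 1) -> ev m f = ev p (w \* f) / z.
Proof.
move=> mp w01 z0 wz m; have [p0 _] := mp.
have w0 k : 0 <= w k by case/andP: (w01 k).
have m0 j : 0 <= m j by rewrite divr_ge0 ?mulr_ge0// ltW.
split; first split => //.
  have -> : (\sum_(k <oo) (m k)%:E = \sum_(k <oo) (z^-1)%:E * (p k * w k)%:E)%E.
    by apply: eq_eseriesr => k _; rewrite -EFinM mulrC.
  rewrite nneseriesZl; last by move=> k _; rewrite lee_fin mulr_ge0.
  by rewrite -(evE mp w01) wz -EFinM mulVf// gt_eqF.
move=> f f01; rewrite /ev.
have -> : (fun k => m k * f k) = z^-1 *: (fun k => p k * (w \* f) k).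
  by apply/funext => k; rewrite fctE /m /GRing.scale/=; ring.
rewrite (lim_seriesZ z^-1 (f := fun k => p k * (w \* f) k)) 1?mulrC//.
apply: (@ev_cvg _ _ 1) => // k; have := w01 k; have := f01 k => /andP[? ?] /andP[? ?].
by rewrite /= ger0_norm ?mulr_ge0// mulr_ile1.
Qed.

Lemma ev_restrict p f K : mass p -> (forall k, 0 <= f k <= 1) ->
  ev p (fun k => f k * (k < K)%N%:R) = \sum_(0 <= k < K) p k * f k.
Proof.
move=> mp f01; have [p0 _] := mp.
have fK01 k : 0 <= f k * (k < K)%N%:R <= 1.
  by have := f01 k; case: (k < K)%N; rewrite ?mulr0 ?mulr1 ?lexx ?ler01.
have H J : \sum_(0 <= k < J) p k * (f k * (k < K)%N%:R) =
    \sum_(0 <= k < minn J K) p k * f k.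
  rewrite !big_mkord (big_ord_widen _ (fun k => p k * f k) (geq_minl J K)).
  rewrite [RHS]big_mkcond /=; apply: eq_bigr => k _.
  by rewrite leq_min ltn_ord /=; case: (k < K)%N; rewrite ?mulr1 ?mulr0.
apply/eqP; rewrite eq_le; apply/andP; split; last first.
  by have /andP[+ _] := ev_trunc K mp fK01; rewrite H minnn.
apply: limr_le; first by apply: (@ev_cvg _ _ 1) => //; exact: norm01.
apply: nearW => J; rewrite seriesEnat /= H !big_mkord.
rewrite (big_ord_widen _ (fun k => p k * f k) (geq_minr J K)) [leLHS]big_mkcond /=.
apply: ler_sum => k _; case: ifP => // _; rewrite mulr_ge0//.
by case/andP: (f01 k).
Qed.

(** Completeness of the mass functions in total variation. The Cauchy bound is uniform in [f], and
    this is what prevents mass from escaping to infinity. *)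
Lemma mass_limit (l : nat -> nat -> R) (theta : nat -> R) :
  (forall n, mass (l n)) -> theta @ \oo --> (0 : R) ->
  (forall n m f, (n <= m)%N -> (forall k, 0 <= f k <= 1) ->
     `|ev (l n) f - ev (l m) f| <= theta n) ->
  exists2 p, mass p & forall n f, (forall k, 0 <= f k <= 1) ->
     `|ev (l n) f - ev p f| <= theta n.
Proof.
move=> ml th0 cau.
pose L f := limn (fun n => ev (l n) f).
have cL f : (forall k, 0 <= f k <= 1) -> (fun n => ev (l n) f) @ \oo --> L f.
  move=> f01; apply: cauchy_cvg; apply/cauchy_exP => e e0.
  have /cvgrPdist_lt /(_ e e0) [N _ HN] := th0.
  exists (ev (l N) f); exists N => // m /= Nm.
  rewrite /ball /=; apply: le_lt_trans (cau _ _ f Nm f01) _.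
  have := HN N (leqnn N); rewrite /= sub0r normrN; apply: le_lt_trans.
  exact: ler_norm.
have dL n f : (forall k, 0 <= f k <= 1) -> `|ev (l n) f - L f| <= theta n.
  move=> f01.
  have H : (fun m => `|ev (l n) f - ev (l m) f|) @ \oo --> `|ev (l n) f - L f|.
    apply: cvg_norm; apply: cvgB; first exact: cvg_cst.
    exact: cL.
  rewrite -(cvg_lim _ H)//; apply: limr_le; first by apply/cvg_ex; eexists; exact: H.
  by exists n => // m nm; exact: cau.
have delta01 (j k : nat) : 0 <= ((k == j)%:R : R) <= 1.
  by case: (k == j); rewrite ?lexx ?ler01.
pose p j := L (fun k => (k == j)%:R).
have p0 j : 0 <= p j.
  apply: limr_ge; first by apply/cvg_ex; eexists; exact: (cL _ (delta01 j)).
  by apply: nearW => n; case/andP: (ev01 (ml n) (delta01 j)).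
have lp j : (fun n => l n j) @ \oo --> p j.
  have := cL _ (delta01 j).
  by under eq_fun do rewrite (ev_delta _ (ml _)).
have pK f K : (forall k, 0 <= f k <= 1) ->
    \sum_(0 <= k < K) p k * f k = L (fun k => f k * (k < K)%N%:R).
  move=> f01; apply/esym/cvg_lim => //.
  under eq_fun do rewrite (ev_restrict _ (ml _) f01).
  by apply: cvg_sum_nat => k; apply: cvgM; [exact: lp|exact: cvg_cst].
(* Tightness: one [l n] close to all later ones controls the tail. The error is at most twice
   [theta n] plus the tail of [l n], three quarters of [e]. *)
have pL f : (forall k, 0 <= f k <= 1) ->
    (fun K => \sum_(0 <= k < K) p k * f k) @ \oo --> L f.
  move=> f01; apply/cvgrPdist_lt => e e0.
  have e40 : 0 < e / 4 by rewrite divr_gt0.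
  have /cvgrPdist_lt /(_ _ e40) [n _ /(_ n (leqnn n))] := th0.
  rewrite /= sub0r normrN => /(le_lt_trans (ler_norm _)) thn.
  have /cvgrPdist_lt /(_ _ e40) := mass_series (ml n).
  apply: filterS => K; rewrite seriesEnat /= => tail; rewrite pK//.
  have fK01 k : 0 <= f k * (k < K)%N%:R <= 1.
    by have := f01 k; case: (k < K)%N; rewrite ?mulr0 ?mulr1 ?lexx ?ler01.
  have := dL n f f01; have := dL n _ fK01; rewrite (ev_restrict K (ml n) f01).
  have := ev_trunc K (ml n) f01.
  move: tail; rewrite !ltr_norml !ler_norml => /andP[? ?] /andP[? ?] /andP[? ?] /andP[? ?].
  apply/andP; split; lra.
have mp : mass p.
  split=> //.
  have one01 (k : nat) : 0 <= (1 : R) <= 1 by rewrite ler01 lexx.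
  have L1 : L (fun=> 1) = 1.
    apply: cvg_lim => //; under eq_fun do rewrite (ev_cst _ (ml _)).
    exact: cvg_cst.
  have := pL _ one01; rewrite L1 => /cvg_lim H.
  transitivity ((limn (fun K => \sum_(0 <= k < K) p k * 1))%:E); last by rewrite H.
  rewrite -EFin_lim; last by apply/cvg_ex; exists 1; move: (pL _ one01); rewrite L1.
  congr (limn _); apply/funext => K /=; rewrite sumEFin; congr EFin.
  by apply: eq_bigr => k _; rewrite mulr1.
exists p => // n f f01.
suff -> : ev p f = L f by exact: dL.
by apply: cvg_lim => //; rewrite seriesEnat; exact: pL.
Qed.

End Expectation.

(** * Transition functions and the backward equation *)

Section TransitionFunction.
Variables (R : realType) (q : nat -> nat -> R) (P : R -> nat -> nat -> R).
Hypotheses (tP : transition_function P) (qP : has_rates q P).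

Lemma tf_mass t i : 0 <= t -> mass (P t i).
Proof. by case: tP => P0 P1 _ _ t0; split => [k|]; [exact: P0|exact: P1]. Qed.

Lemma tf01 t i j : 0 <= t -> 0 <= P t i j <= 1.
Proof.
move=> t0; have m := tf_mass i t0; rewrite -(ev_delta j m).
by apply: ev01 => // k; case: eqP; rewrite ?lexx ?ler01.
Qed.

Lemma tf_CK s t i j : 0 <= s -> 0 <= t ->
  P (s + t) i j = ev (P s i) (fun k => P t k j).
Proof.
move=> s0 t0; apply: EFin_inj; rewrite (evE (tf_mass i s0) (C := 1)).
  by case: tP => _ _ _ ->.
by move=> k; exact: tf01.
Qed.

Lemma tf_CKf s t i f : 0 <= s -> 0 <= t -> (forall k, 0 <= f k <= 1) ->
  ev (P (s + t) i) f = ev (P s i) (fun k => ev (P t k) f).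
Proof.
move=> s0 t0 f01.
have [_ <-//] := ev_mix (tf_mass i s0) (fun k => tf_mass k t0).
by congr (ev _ _); apply/funext => j; rewrite tf_CK.
Qed.

Lemma tf0 i j : P 0 i j = (i == j)%:R.
Proof. by case: tP. Qed.

Lemma tf_mul s t i k j : 0 <= s -> 0 <= t ->
  P s i k * P t k j <= P (s + t) i j.
Proof.
move=> s0 t0; rewrite tf_CK//.
by apply: (ev_ge_term (f := fun k => P t k j) k (tf_mass i s0)) => l; exact: tf01.
Qed.

(** Take the short step first: the chain is still at [i] at time [h] with probability [P h i i], and
    the other states contribute at most 1 - [P h i i]. The bound is uniform in [t] and [j], so
    continuity at time 0 spreads to all times. *)
Lemma tf_modulus t h i j : 0 <= t -> 0 <= h ->
  `|P (t + h) i j - P t i j| <= 1 - P h i i.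
Proof.
move=> t0 h0; rewrite (addrC t) ler_norml; have := tf_mul i i j h0 t0.
have : P (h + t) i j <= P h i i * P t i j + (1 - P h i i).
  rewrite tf_CK//.
  by apply: (ev_le_term (f := fun k => P t k j) i (tf_mass i h0)) => l; exact: tf01.
have /andP[a0 a1] := tf01 i i h0; have /andP[b0 b1] := tf01 i j t0.
have : 0 <= (1 - P h i i) * (1 - P t i j) by rewrite mulr_ge0 ?subr_ge0.
have : 0 <= (1 - P h i i) * P t i j by rewrite mulr_ge0 ?subr_ge0.
nra.
Qed.

Lemma tf_right0 i : P h i i @[h --> 0^'+] --> (1 : R).
Proof.
have h0 : h @[h --> (0:R)^'+] --> (0 : R) by apply: cvg_within.
have H : (P h i i - (i == i)%:R) / h * h + 1 @[h --> 0^'+] --> q i i * 0 + 1.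
  by apply: cvgD; [apply: cvgM => //; exact: qP|exact: cvg_cst].
rewrite mulr0 add0r in H; apply: cvg_trans H; apply: near_eq_cvg.
near=> h; have hp : 0 < h by near: h; exact: nbhs_right_gt.
by rewrite eqxx /= divfK ?subrK// lt0r_neq0.
Unshelve. all: by end_near. Qed.

Lemma tf_stay0_near i e : 0 < e -> \forall h \near 0^'+, 1 - P h i i < e.
Proof.
move=> e0; have /cvgrPdist_lt /(_ e e0) := tf_right0 i.
by apply: filterS => h; exact: le_lt_trans (ler_norm _).
Qed.

(** Nothing is known of [P] at negative times; the absolute value gives a function continuous on the
    whole line. *)
Lemma tf_continuous i j : continuous (fun t : R => P `|t| i j).
Proof.
move=> t; apply/cvgrPdist_lt => e e0.
have [d /= d0 Hd] := tf_stay0_near i e0.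
have Hh h : 0 <= h -> h < d -> 1 - P h i i < e.
  rewrite le_eqVlt => /orP[/eqP<- _|h0 hd]; first by rewrite tf0 eqxx subrr.
  by apply: Hd => //=; rewrite sub0r normrN gtr0_norm.
near=> s; have st : `|t - s| < d by near: s; exact: cvgr_dist_lt.
have st' : `| `|t| - `|s| | < d by apply: le_lt_trans st; exact: ler_dist_dist.
case: (leP `|s| `|t|) => [le|/ltW le].
  have sub0 : 0 <= `|t| - `|s| by rewrite subr_ge0.
  rewrite -(subrK `|s| `|t|) (addrC _ `|s|).
  apply: le_lt_trans (tf_modulus _ _ _ sub0) _ => //.
  by apply: Hh => //; rewrite -(ger0_norm sub0).
have sub0 : 0 <= `|s| - `|t| by rewrite subr_ge0.
rewrite distrC -(subrK `|t| `|s|) (addrC _ `|t|).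
apply: le_lt_trans (tf_modulus _ _ _ sub0) _ => //.
by apply: Hh => //; rewrite -(ger0_norm sub0) distrC.
Unshelve. all: by end_near. Qed.

Lemma tf_left t i j : 0 < t -> P (t - h) i j @[h --> 0^'+] --> P t i j.
Proof.
move=> t0; apply/cvgrPdist_lt => e e0; near=> h.
have h0 : 0 < h by near: h; exact: nbhs_right_gt.
have ht : h < t by near: h; exact: nbhs_right_lt.
rewrite -{1}(subrK h t); apply: le_lt_trans (tf_modulus _ _ _ (ltW h0)) _.
  by rewrite subr_ge0 ltW.
by near: h; exact: tf_stay0_near.
Unshelve. all: by end_near. Qed.

Lemma sum_delta (x K : nat) (f : nat -> R) : (x < K)%N ->
  \sum_(0 <= k < K) (x == k)%:R * f k = f x.
Proof.
move=> xK; rewrite big_mkord (bigD1 (Ordinal xK))//= eqxx mul1r big1 ?addr0//.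
move=> k; rewrite -val_eqE eq_sym /= => /negbTE ->; exact: mul0r.
Qed.

(* Only finitely many terms of the backward equation are kept; the error of
   the upper bound is the rate of jumps beyond K. *)
Lemma tf_backward t x j K e : 0 < t -> (x < K)%N -> 0 < e ->
  \forall h \near 0^'+,
    h * (\sum_(0 <= k < K) q x k * P t k j - e) <= P t x j - P (t - h) x j
    <= h * (\sum_(0 <= k < K) q x k * P t k j - \sum_(0 <= k < K) q x k + e).
Proof.
move=> t0 xK e0.
(* Here h * F h is the increment of P over the last [h], with the intermediate state kept below [K],
   and - h * G h is the probability of a state at or beyond [K] after [h]; [ev_trunc] bounds the
   error by the latter. *)
pose F h := \sum_(0 <= k < K) (P h x k - (x == k)%:R) / h * P (t - h) k j.
pose G h := \sum_(0 <= k < K) (P h x k - (x == k)%:R) / h.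
have cF : F h @[h --> 0^'+] --> \sum_(0 <= k < K) q x k * P t k j.
  by apply: cvg_sum_nat => k; apply: cvgM; [exact: qP|exact: tf_left].
have cG : G h @[h --> 0^'+] --> \sum_(0 <= k < K) q x k.
  by apply: cvg_sum_nat => k; exact: qP.
have e20 : 0 < e / 2 by rewrite divr_gt0.
near=> h.
have h0 : 0 < h by near: h; exact: nbhs_right_gt.
have ht : h < t by near: h; exact: nbhs_right_lt.
have th0 : 0 <= t - h by rewrite subr_ge0 ltW.
have dF : `|\sum_(0 <= k < K) q x k * P t k j - F h| < e / 2.
  by near: h; move/cvgrPdist_lt : cF; exact.
have dG : `|\sum_(0 <= k < K) q x k - G h| < e / 2.
  by near: h; move/cvgrPdist_lt : cG; exact.
have FE : h * F h = \sum_(0 <= k < K) P h x k * P (t - h) k j - P (t - h) x j.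
  rewrite -(sum_delta (fun k => P (t - h) k j) xK) -sumrB /F mulr_sumr.
  by apply: eq_bigr => k _; field; exact: lt0r_neq0.
have GE : h * G h = \sum_(0 <= k < K) P h x k - 1.
  rewrite -(sum_delta (fun=> 1) xK) -sumrB /G mulr_sumr.
  by apply: eq_bigr => k _; field; exact: lt0r_neq0.
have := @ev_trunc _ (P h x) (fun k => P (t - h) k j) K (tf_mass x (ltW h0))
  (fun k => tf01 k j th0).
rewrite -tf_CK ?(ltW h0)// (addrC h) subrK.
move: dF dG; rewrite !ltr_norml.
set A := \sum_(0 <= k < K) q x k * _; set B := \sum_(0 <= k < K) q x k.
move=> /andP[a1 a2] /andP[b1 b2] /andP[c1 c2].
have : h * (A - e) <= h * F h by rewrite ler_pM2l//; lra.
have : h * F h - h * G h <= h * (A - B + e) by rewrite -mulrBr ler_pM2l//; lra.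
by rewrite FE GE; lra.
Unshelve. all: by end_near. Qed.

(** P_{s+t}(x,x) is at least P_s(x,x) P_t(x,x), so a bound valid for short times propagates to all
    times. The strict inequality on [lam] pays for the linearisation at 0. *)
Lemma tf_stay x lam t : - q x x < lam -> 0 <= t -> expR (- lam * t) <= P t x x.
Proof.
move=> qlam t0.
have [d /= d0 Hd] : \forall h \near 0^'+, expR (- lam * h) <= P h x x.
  (* The midpoint of - q x x and lam. For small h, e^{-lam h} <= 1 / (1 + lam h) <= 1 - a h <
     P_h(x,x). *)
  have [a al e0] : exists2 a, 0 < lam - a & 0 < q x x + a.
    by exists ((lam - q x x) / 2); lra.
  have := @qP x x; rewrite eqxx => /cvgrPdist_lt /(_ _ e0) cq.
  near=> h.
  have h0 : 0 < h by near: h; exact: nbhs_right_gt.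
  have Ph : 1 - a * h < P h x x.
    have : `|q x x - (P h x x - 1) / h| < q x x + a by near: h.
    rewrite ltr_norml => /andP[_]; rewrite ltrD2l ltrNl ltr_pdivlMr//; lra.
  apply: le_trans (ltW Ph).
  have hlam : `|lam| * h < 1.
    have : h < (`|lam| + 1)^-1 by near: h; apply: nbhs_right_lt; rewrite invr_gt0 ltr_wpDl.
    rewrite -[X in _ < X]div1r ltr_pdivlMr ?ltr_wpDl//; lra.
  have hal : `|a * lam| * h < lam - a.
    have : h < (lam - a) / (`|a * lam| + 1).
      by near: h; apply: nbhs_right_lt; rewrite divr_gt0// ltr_wpDl.
    by rewrite ltr_pdivlMr ?(ltr_wpDl (normr_ge0 _))//; lra.
  have lh : 0 < 1 + lam * h.
    have : - lam * h <= `|lam| * h by rewrite ler_wpM2r ?(ltW h0)// -normrN ler_norm.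
    lra.
  rewrite mulNr expRN; apply: (@le_trans _ _ (1 + lam * h)^-1).
    by rewrite lef_pV2 ?posrE ?expR_gt0//; exact: expR_ge1Dx.
  rewrite -[X in X <= _]div1r ler_pdivrMr//.
  have : a * lam * h <= `|a * lam| * h by rewrite ler_wpM2r ?(ltW h0)// ler_norm.
  move=> H1; have : 0 <= h * ((lam - a) - a * lam * h) by rewrite mulr_ge0 ?(ltW h0)//; lra.
  lra.
have iter h n : 0 <= h -> expR (- lam * h) <= P h x x ->
    expR (- lam * (n%:R * h)) <= P (n%:R * h) x x.
  move=> h0 Hh; elim: n => [|n IH].
    by rewrite mul0r mulr0 expR0 tf0 eqxx.
  have nh : 0 <= n%:R * h by rewrite mulr_ge0.
  rewrite -natr1 mulrDl mul1r; apply: le_trans (tf_mul x x x nh h0).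
  by rewrite mulrDr expRD ler_pM ?expR_ge0.
pose n := (Num.truncn (t / d)).+1.
have nR : 0 < n%:R :> R by rewrite ltr0n.
have tn : t / n%:R < d.
  have : t / d < n%:R by exact: truncnS_gt.
  by rewrite !ltr_pdivrMr// mulrC.
have tE : t = n%:R * (t / n%:R) by field; exact: lt0r_neq0.
rewrite tE; apply: iter; first by rewrite divr_ge0.
case: (ltP 0 (t / n%:R)) => [h0|hle].
  by apply: Hd => //=; rewrite sub0r normrN gtr0_norm.
have -> : t / n%:R = 0 by apply/eqP; rewrite eq_le hle divr_ge0.
by rewrite mulr0 expR0 tf0 eqxx.
Unshelve. all: by end_near. Qed.

End TransitionFunction.

(** * The maximum principle *)

Lemma finite_argmax (R : realType) (g : nat -> R) N : (0 < N)%N ->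
  exists2 x : nat, (x < N)%N & forall k, (k < N)%N -> g k <= g x.
Proof.
case: N => // N _; elim: N => [|N [x xN Hx]].
  by exists 0%N => // k; rewrite ltnS leqn0 => /eqP ->.
have [gx|gx] := leP (g x) (g N.+1).
  exists N.+1 => // k; rewrite ltnS leq_eqVlt => /orP[/eqP ->//|kN].
  exact: le_trans (Hx k kN) gx.
exists x => [|k]; first exact: leqW.
rewrite ltnS leq_eqVlt => /orP[/eqP ->|kN]; [exact: ltW|exact: Hx].
Qed.

Section MaximumPrinciple.
Variables (R : realType) (q : nat -> nat -> R) (c : R).
Hypothesis q_ge0 : forall x k, x != k -> 0 <= q x k.
Hypothesis c_ge0 : 0 <= c.
Hypothesis q_lyapunov : forall x K, (x < K)%N ->
  \sum_(0 <= k < K) q x k * (k%:R + 1) <= c * (x%:R + 1).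
Hypothesis q_conservative : forall x e, 0 < e ->
  exists2 K, (x < K)%N & - \sum_(0 <= k < K) q x k <= e.

(* The function k + 1 tends to infinity, so that e^{-(c+1)t} u_t(k) / (k + 1),
   if positive somewhere, attains its maximum on [0, T] x nat; the differential
   inequality fails there. *)
Lemma max_principle (T : R) (G : nat -> Prop) (u : R -> nat -> R) :
  (forall x t, 0 <= t <= T -> u t x <= 1) ->
  (forall x, G x -> continuous (fun t : R => u `|t| x)) ->
  (forall x t, 0 <= t <= T -> ~ G x -> u t x <= 0) ->
  (forall x, u 0 x <= 0) ->
  (forall x t K e, G x -> 0 < t <= T -> (x < K)%N -> 0 < e ->
     \forall h \near 0^'+, u t x - u (t - h) x <=
       h * (\sum_(0 <= k < K) q x k * u t k - \sum_(0 <= k < K) q x k + e)) ->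
  forall x t, 0 <= t <= T -> u t x <= 0.
Proof.
move=> u1 uc uG u0 ud x1 t1 t1T; rewrite leNgt; apply/negP => u_gt0.
pose w s k := expR (- (c + 1) * s) * u s k / (k%:R + 1).
have k1 k : 0 < k%:R + 1 :> R by rewrite ltr_wpDl.
have T0 : 0 <= T by case/andP: t1T => a b; exact: le_trans a b.
(* For each state a time at which [w] is maximal. The truncation at 0 covers the states outside [G],
   where [u] is at most 0 but no continuity is assumed. *)
have [f Hf] : {f : nat -> R & forall k, 0 <= f k <= T /\
    forall s, 0 <= s <= T -> w s k <= Num.max (w (f k) k) 0}.
  apply: (@choice _ _ (fun k t => 0 <= t <= T /\
    forall s, 0 <= s <= T -> w s k <= Num.max (w t k) 0)) => k.
  have [Gk|nGk] := pselect (G k); last first.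
    exists 0; split=> [|s s0]; first by rewrite lexx.
    rewrite le_max; apply/orP; right.
    rewrite /w pmulr_lle0 ?invr_gt0// pmulr_rle0 ?expR_gt0//.
    exact: uG.
  have wc : continuous (fun s : R => expR (- (c + 1) * s) * u `|s| k / (k%:R + 1)).
    move=> s; apply: cvgM; last exact: cvg_cst.
    apply: cvgM; last exact: uc.
    apply: continuous_comp; last exact: continuous_expR.
    by apply: cvgM; [exact: cvg_cst|exact: cvg_id].
  have [t] := EVT_max T0 (continuous_subspaceT wc).
  rewrite in_itv /= => tT tmax; exists t; split => // s sT.
  rewrite le_max; apply/orP; left.
  have := tmax s; rewrite in_itv /= => /(_ sT).
  by rewrite /w !ger0_norm; [|by case/andP: tT|by case/andP: sT].
pose g k := Num.max (w (f k) k) 0.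
have w1 : 0 < w t1 x1 by rewrite /w divr_gt0// mulr_gt0 ?expR_gt0.
have wle k : w (f k) k <= (k%:R + 1)^-1.
  have [/andP[f0 fT] _] := Hf k.
  rewrite /w ler_pdivrMr// mulVf ?gt_eqF//.
  have e1 : expR (- (c + 1) * f k) <= 1.
    by rewrite -expR0 ler_expR mulNr oppr_le0 mulr_ge0// addr_ge0.
  have [u_ge0|u_lt0] := leP 0 (u (f k) k).
    by rewrite mulr_ile1 ?expR_ge0// u1// f0.
  by apply: (@le_trans _ _ 0); [rewrite pmulr_rle0 ?expR_gt0// ltW|exact: ler01].
(* As u <= 1, w is at most 1 / (k + 1), which is below the positive value [w t1 x1] for k >= N: only
   finitely many states compete. *)
pose N := (Num.truncn (w t1 x1)^-1).+1.
have gsmall k : (N <= k)%N -> g k < w t1 x1.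
  move=> Nk; rewrite gt_max w1 andbT; apply: le_lt_trans (wle k) _.
  rewrite -[ltRHS]invrK ltf_pV2 ?posrE ?invr_gt0//.
  apply: (@lt_trans _ _ k%:R); last by rewrite ltrDl.
  by apply: lt_le_trans (truncnS_gt _) _; rewrite ler_nat.
have [y yN ymax] := finite_argmax g (ltn0Sn (Num.truncn (w t1 x1)^-1)).
have gw1 : w t1 x1 <= g x1 by have [_] := Hf x1; apply.
have x1N : (x1 < N)%N.
  by rewrite ltnNge; apply/negP => /gsmall; rewrite ltNge gw1.
have gy : w t1 x1 <= g y by apply: le_trans gw1 _; exact: ymax.
have gmax s k : 0 <= s <= T -> w s k <= g y.
  move=> sT; have [_ /(_ s sT) /le_trans] := Hf k; apply.
  have [kN|Nk] := ltnP k N; first exact: ymax.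
  exact: le_trans (ltW (gsmall k Nk)) gy.
have {gy} gy0 : 0 < g y by apply: lt_le_trans gy.
have {}gyE : g y = w (f y) y 
  by move: gy0; rewrite /g lt_max ltxx orbF => wy; rewrite max_l// ltW.
move: (f y) (proj1 (Hf y)) gyE => t tT gyE {Hf wle ymax gsmall gw1}.
pose m := g y * expR ((c + 1) * t).
have m0 : 0 < m by rewrite mulr_gt0 ?expR_gt0.
have um k s : 0 <= s <= T -> u s k <= g y * expR ((c + 1) * s) * (k%:R + 1).
  move=> sT; have := gmax s k sT; rewrite /w ler_pdivrMr// => H.
  rewrite mulrAC -ler_pdivrMr ?expR_gt0// -expRN mulrC -mulNr.
  exact: H.
have uE : u t y = m * (y%:R + 1).
  have E1 : expR (- (c + 1) * t) * expR ((c + 1) * t) = 1.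
    by rewrite -expRD mulNr addNr expR0.
  rewrite /m gyE /w.
  transitivity (u t y * (expR (- (c + 1) * t) * expR ((c + 1) * t))).
    by rewrite E1 mulr1.
  by field; rewrite gt_eqF.
have Gy : G y.
  apply: contrapT => nG; have := uG y t tT nG.
  by rewrite uE leNgt mulr_gt0.
have t_gt0 : 0 < t.
  case/andP: tT => + _; rewrite le_eqVlt => /orP[/eqP t0|//].
  have : 0 < u t y by rewrite uE mulr_gt0.
  by rewrite -t0 ltNge u0.
set M := m * (y%:R + 1) in uE.
have M0 : 0 < M by rewrite /M mulr_gt0.
(* One quarter for the row sum defect, one for the error of the differential inequality: with c M
   from the Lyapunov bound the growth rate stays below (c + 1/2) M. *)
have M4 : 0 < M / 4 by rewrite divr_gt0.
have [K yK qK] := q_conservative y M4.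
have tT' : 0 < t <= T by rewrite t_gt0; case/andP: tT.
have near_d := ud y t K _ Gy tT' yK M4.
have sumq : \sum_(0 <= k < K) q y k * u t k <= c * M.
  have : m * (\sum_(0 <= k < K) q y k * (k%:R + 1)) <= m * (c * (y%:R + 1)).
    by rewrite ler_pM2l// q_lyapunov.
  rewrite [X in _ <= X -> _]mulrCA -/M; apply: le_trans.
  rewrite mulr_sumr; apply: ler_sum => k _; rewrite mulrCA.
  have [<-|yk] := eqVneq y k; first by rewrite uE.
  by rewrite ler_wpM2l ?q_ge0// um.
(* Maximality at (t, y) forces u(t - h, y) <= M e^{-(c+1)h}, a decrease at rate c + 1 going back in
   time, but the differential inequality allows only c + 1/2. This bound on [h] makes second order
   terms too small to reconcile the two. *)
have d_gt0 : 0 < (2 * (c + 1) ^+ 2)^-1 by rewrite invr_gt0 mulr_gt0// exprn_gt0// ltr_wpDl.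
have [h [h0 ht hd hu]] : exists h, [/\ 0 < h, h < t, h < (2 * (c + 1) ^+ 2)^-1 &
    u t y - u (t - h) y <=
       h * (\sum_(0 <= k < K) q y k * u t k - \sum_(0 <= k < K) q y k + M / 4)].
  apply: (@filter_ex _ (0 : R)^'+); near=> h; split; near: h => //.
  - exact: nbhs_right_gt.
  - exact: nbhs_right_lt.
  - exact: nbhs_right_lt.
have thT : 0 <= t - h <= T by case/andP: tT => _ ?; lra.
have uh : u (t - h) y * (1 + (c + 1) * h) <= M.
  have [u_ge0|u_lt0] := leP 0 (u (t - h) y); last first.
    apply: le_trans (ltW M0); rewrite mulr_le0_ge0 ?(ltW u_lt0)//.
    by rewrite addr_ge0// mulr_ge0 ?(ltW h0)// addr_ge0.
  have := um y (t - h) thT.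
  rewrite -(ler_pM2r (expR_gt0 ((c + 1) * h))).
  have Et : expR ((c + 1) * t) = expR ((c + 1) * (t - h)) * expR ((c + 1) * h).
    by rewrite -expRD -mulrDr subrK.
  rewrite [X in _ <= X -> _](_ : _ = M); last by rewrite /M /m Et; ring.
  apply: le_trans.
  by rewrite ler_wpM2l// expR_ge1Dx.
have hM : 0 < h * M by rewrite mulr_gt0.
have H1 : M * ((c + 1) * h) <= (M - u (t - h) y) * (1 + (c + 1) * h) by lra.
have H2 : M - u (t - h) y <= h * M * (c + 1 / 2).
  rewrite -{1}uE; apply: (le_trans hu); rewrite -mulrA ler_pM2l//; lra.
have c1h : 0 < 1 + (c + 1) * h by rewrite ltr_wpDr// mulr_ge0 ?(ltW h0)// addr_ge0.
have H3 : h * M * (c + 1) <= h * M * ((c + 1 / 2) * (1 + (c + 1) * h)).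
  rewrite [X in _ <= X]mulrA; apply: (@le_trans _ _ ((M - u (t - h) y) * (1 + (c + 1) * h))).
    by rewrite (_ : h * M * (c + 1) = M * ((c + 1) * h)) //; ring.
  by rewrite ler_pM2r.
move: H3; rewrite ler_pM2l//.
move: hd; rewrite -[X in _ < X]div1r ltr_pdivlMr; last by rewrite mulr_gt0// exprn_gt0// ltr_wpDl.
move=> hd.
have : (c + 1 / 2) * (c + 1) * h <= (c + 1) ^+ 2 * h.
  by rewrite ler_wpM2r ?(ltW h0)// expr2 ler_wpM2r ?addr_ge0//; lra.
lra.
Unshelve. all: by end_near. Qed.

End MaximumPrinciple.

(** * Consequences for the transition function *)

Lemma expR_sub1_near (R : realType) (lam e : R) : 0 < lam -> 0 < e ->
  \forall h \near 0^'+, expR (lam * h) - 1 <= h * (lam + e).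
Proof.
move=> lam0 e0; have le0 : 0 < (lam + e) * lam by rewrite mulr_gt0// addr_gt0.
near=> h.
have h0 : 0 < h by near: h; exact: nbhs_right_gt.
have h1 : lam * h < 1.
  have : h < lam^-1 by near: h; apply: nbhs_right_lt; rewrite invr_gt0.
  by rewrite -[X in _ < X]div1r ltr_pdivlMr// mulrC.
have h2 : (lam + e) * lam * h < e.
  have : h < e / ((lam + e) * lam) by near: h; apply: nbhs_right_lt; rewrite divr_gt0.
  by rewrite ltr_pdivlMr// mulrC.
have E0 := expR_gt0 (lam * h).
have : (1 - lam * h) * expR (lam * h) <= 1.
  have := expR_ge1Dx (- (lam * h)); rewrite -(ler_pM2r E0) -expRD addNr expR0.
  by [].
have {}h1 : 0 < 1 - lam * h by lra.
move=> H; rewrite -(ler_pM2l h1).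
have : 0 <= h * (e - (lam + e) * lam * h) by rewrite mulr_ge0 ?(ltW h0)//; lra.
lra.
Unshelve. all: by end_near. Qed.

Section Generator.
Variables (R : realType) (q : nat -> nat -> R) (c : R).
Hypothesis q_ge0 : forall x k, x != k -> 0 <= q x k.
Hypothesis c_ge0 : 0 <= c.
Hypothesis q_lyapunov : forall x K, (x < K)%N ->
  \sum_(0 <= k < K) q x k * (k%:R + 1) <= c * (x%:R + 1).
Hypothesis q_sum_le0 : forall x K, (x < K)%N -> \sum_(0 <= k < K) q x k <= 0.
Hypothesis q_conservative : forall x e, 0 < e ->
  exists2 K, (x < K)%N & - \sum_(0 <= k < K) q x k <= e.

(** The upper backward bound for one function minus the lower bound for the other is the
    differential inequality of [max_principle] for their difference; then exchange the roles. *)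
Lemma tf_unique P P' : transition_function P -> has_rates q P ->
  transition_function P' -> has_rates q P' ->
  forall t x j, 0 <= t -> P t x j = P' t x j.
Proof.
suff H Q Q' : transition_function Q -> has_rates q Q ->
    transition_function Q' -> has_rates q Q' ->
    forall t x j, 0 <= t -> Q t x j <= Q' t x j.
  by move=> tP qP tP' qP' t x j t0; apply/eqP; rewrite eq_le !H.
move=> tP qP tP' qP' t x j t0; rewrite -subr_le0.
apply: (max_principle q_ge0 c_ge0 q_lyapunov q_conservative (T := t)
  (G := fun=> True) (u := fun t x => Q t x j - Q' t x j)) => {x}.
- move=> x s /andP[s0 _].
  by have := tf01 tP x j s0; have := tf01 tP' x j s0; lra.
- move=> x _ s; apply: cvgB.
    exact: (tf_continuous tP qP).
  exact: (tf_continuous tP' qP').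
- by move=> ? ? ? /(_ I).
- by move=> x; rewrite !tf0// subrr.
- move=> x s K e _ /andP[s0 _] xK e0; have e20 : 0 < e / 2 by rewrite divr_gt0.
  have := tf_backward tP qP j s0 xK e20; have := tf_backward tP' qP' j s0 xK e20.
  apply: filterS2 => h.
  have -> : \sum_(0 <= k < K) q x k * (Q s k j - Q' s k j) =
    \sum_(0 <= k < K) q x k * Q s k j - \sum_(0 <= k < K) q x k * Q' s k j.
    by rewrite -sumrB; apply: eq_bigr => k _; rewrite mulrBr.
  lra.
- by rewrite t0 lexx.
Qed.

Variables (P : R -> nat -> nat -> R).
Hypotheses (tP : transition_function P) (qP : has_rates q P).
Variables (W : nat -> R) (N : nat) (lam : R).
Hypothesis W12 : forall k, 1 <= W k <= 2.
Hypothesis lam_gt0 : 0 < lam.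
Hypothesis N_gt0 : (0 < N)%N.
(** The subsolution of [tf_minorization] contains the indicator of the positive states; without
    direct jumps to 0 from x > N, the generator sees it there as the constant 1. *)
Hypothesis q_skipfree : forall x, (1 < x)%N -> q x 0%N = 0.
Hypothesis W_drift : forall x K, (N < x)%N -> (x < K)%N ->
  \sum_(0 <= k < K) q x k * (W k - W x) <= - lam * W x.

Lemma sum_qW x K : (N < x)%N -> (x < K)%N ->
  \sum_(0 <= k < K) q x k * W k <= - lam * W x.
Proof.
move=> Nx xK; apply: le_trans (W_drift Nx xK).
have -> : \sum_(0 <= k < K) q x k * (W k - W x) =
   \sum_(0 <= k < K) q x k * W k - W x * \sum_(0 <= k < K) q x k.
  by rewrite mulr_sumr -sumrB; apply: eq_bigr => k _; ring.
have := q_sum_le0 xK; have /andP[W1 _] := W12 x => S0.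
have : W x * \sum_(0 <= k < K) q x k <= 0 by rewrite mulr_ge0_le0//; lra.
lra.
Qed.

(* Compares P_{t+1}(x, 1) with the subsolution delta (1 - e^{-lam t} W x). *)
Lemma tf_minorization T delta : 0 <= T -> 0 <= delta <= 1 ->
  (forall x t, (0 < x <= N)%N -> 0 <= t <= T -> delta <= P (t + 1) x 1%N) ->
  forall x, (0 < x)%N -> delta * (1 - 2 * expR (- lam * T)) <= P (T + 1) x 1%N.
Proof.
move=> T0 /andP[d0 d1] Hd x x0.
have [xN|Nx] := leqP x N.
  apply: le_trans (Hd x T _ _); rewrite ?x0 ?lexx ?T0//.
  by rewrite ler_piMr//; have := expR_ge0 (- lam * T); lra.
(* Since W >= 1, v is at most 0 at time 0; since W <= 2, it has risen to 1 - 2 e^{-lam T} at time T.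
   It is a subsolution because its time derivative lam e^{-lam t} W is at most - e^{-lam t} times
   the generator applied to W. *)
pose v (t : R) x : R := (0 < x)%N%:R - expR (- lam * t) * W x.
suff : delta * v T x - P (T + 1) x 1%N <= 0.
  rewrite /v x0 subr_le0; apply: le_trans; rewrite ler_wpM2l//.
  have /andP[_ W2] := W12 x; have := expR_ge0 (- lam * T) => E0.
  have : expR (- lam * T) * W x <= expR (- lam * T) * 2 by rewrite ler_wpM2l.
  by rewrite /=; lra.
have v1 t k : v t k <= 1.
  have /andP[W1 _] := W12 k; rewrite /v.
  have : 0 <= expR (- lam * t) * W k by rewrite mulr_ge0 ?expR_ge0//; lra.
  by case: (0 < k)%N => /=; lra.
have TT : 0 <= T <= T by rewrite T0 lexx.
apply: (max_principle q_ge0 c_ge0 q_lyapunov q_conservative (T := T)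
  (G := (fun x => N < x)%N) (u := fun t x => delta * v t x - P (t + 1) x 1%N)) => //.
- move=> {x Nx x0} x t /andP[t0 _].
  have t10 : 0 <= t + 1 by rewrite addr_ge0.
  have /andP[P0 _] := tf01 tP x 1%N t10.
  have : delta * v t x <= delta * 1 by rewrite ler_wpM2l.
  lra.
- move=> {x Nx x0} x _ t; apply: cvgB.
    apply: cvgM; first exact: cvg_cst.
    apply: cvgB; first exact: cvg_cst.
    apply: cvgM; last exact: cvg_cst.
    apply: continuous_comp; last exact: continuous_expR.
    by apply: cvgM; [exact: cvg_cst|apply: norm_continuous].
  have -> : (fun s : R => P (`|s| + 1) x 1%N) = (fun s : R => P `| `|s| + 1 | x 1%N).
    by apply/funext => s; rewrite [in RHS]ger0_norm// addr_ge0.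
  rewrite -[`|t| + 1]ger0_norm ?addr_ge0//.
  apply: (@continuous_comp _ _ _ (fun s : R => `|s| + 1) (fun s : R => P `|s| x 1%N)).
    by apply: cvgD; [apply: norm_continuous|exact: cvg_cst].
  exact: (tf_continuous tP qP).
- move=> {x Nx x0} [|x] t tT /negP; rewrite -leqNgt => xN.
    have : 0 <= P (t + 1) 0%N 1%N.
      by case/andP: (tf01 tP 0%N 1%N (addr_ge0 (proj1 (andP tT)) ler01)).
    have : 0 <= delta * (expR (- lam * t) * W 0%N).
      by have /andP[W1 _] := W12 0%N; rewrite !mulr_ge0 ?expR_ge0//; lra.
    rewrite /v /=; lra.
  have := Hd x.+1 t xN tT; have : delta * v t x.+1 <= delta by rewrite ler_piMr.
  lra.
- move=> {x Nx x0} x.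
  have /andP[P0 _] := tf01 tP x 1%N (addr_ge0 (lexx 0) ler01).
  have : delta * v 0 x <= 0.
    rewrite mulr_ge0_le0// /v mulr0 expR0 mul1r.
    by have /andP[W1 _] := W12 x; case: (0 < x)%N => /=; lra.
  lra.
- move=> {x Nx x0} x t K e Nx /andP[t0 _] xK e0.
  have e20 : 0 < e / 2 by rewrite divr_gt0.
  have e40 : 0 < e / 4 by rewrite divr_gt0.
  have t10 : 0 < t + 1 by rewrite addr_gt0.
  near=> h.
  have h0 : 0 < h by near: h; exact: nbhs_right_gt.
  have : h * (\sum_(0 <= k < K) q x k * P (t + 1) k 1%N - e / 2) <=
      P (t + 1) x 1%N - P (t + 1 - h) x 1%N.
    near: h; apply: filterS (tf_backward tP qP 1%N t10 xK e20).
    by move=> h /andP[].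
  have E1 : expR (lam * h) - 1 <= h * (lam + e / 4).
    by near: h; exact: expR_sub1_near.
  rewrite (addrAC t 1).
  have -> : \sum_(0 <= k < K) q x k * (delta * v t k - P (t + 1) k 1%N) =
     delta * (\sum_(0 <= k < K) q x k) -
     delta * expR (- lam * t) * (\sum_(0 <= k < K) q x k * W k) -
     \sum_(0 <= k < K) q x k * P (t + 1) k 1%N.
    rewrite !mulr_sumr -!sumrB; apply: eq_bigr => -[|k] _; rewrite /v /=; last by ring.
    by rewrite q_skipfree ?(leq_trans _ Nx)//; ring.
  set A := \sum_(0 <= k < K) q x k * P _ _ _.
  have SW := sum_qW Nx xK; have S0 := q_sum_le0 xK.
  move: SW S0; set B := \sum_(0 <= k < K) _ * _; set S := \sum_(0 <= k < K) _.
  move=> SW S0 HP.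
  rewrite /v (leq_trans _ Nx)//.
  have -> : expR (- lam * (t - h)) = expR (- lam * t) * expR (lam * h).
    by rewrite -expRD; congr expR; ring.
  set E := expR (- lam * t); set H := expR (lam * h) in E1 *.
  have E0 : 0 <= E := expR_ge0 _.
  have E_le1 : E <= 1.
    by rewrite -expR0 ler_expR mulNr oppr_le0 mulr_ge0 ?(ltW lam_gt0) ?(ltW t0).
  have /andP[W1 W2] := W12 x.
  have dE0 : 0 <= delta * E by rewrite mulr_ge0.
  have dE1 : delta * E <= 1 by rewrite mulr_ile1.
  have dEW0 : 0 <= delta * E * W x by rewrite mulr_ge0//; lra.
  have dEW2 : delta * E * W x <= 2 by rewrite -[leRHS]mul1r ler_pM//; lra.
  have K1 : delta * E * W x * (H - 1) <= delta * E * W x * (h * (lam + e / 4)).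
    by rewrite ler_wpM2l.
  have K2 : h * (e / 4) * (delta * E * W x) <= h * (e / 4) * 2.
    by rewrite ler_wpM2l// mulr_ge0 ?(ltW h0)// ltW.
  have K3 : h * (delta * E * B) <= h * (delta * E * (- lam * W x)).
    by rewrite ler_pM2l// ler_wpM2l.
  have K4 : h * ((1 - delta) * S) <= 0.
    by rewrite pmulr_rle0// mulr_ge0_le0//; lra.
  lra.
Unshelve. all: by end_near. Qed.

(* Compares 1 - P_t(x, 0) with the supersolution K0 (1 - P_t(1, 0)) W x. *)
Lemma tf_survival_le K0 : 1 <= K0 ->
  (forall x t, (0 < x <= N)%N -> 0 <= t -> 1 - P t x 0%N <= K0 * (1 - P t 1%N 0%N)) ->
  (forall t, 0 <= t -> expR (- lam * t) <= P t 1%N 1%N) ->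
  (forall t, 0 <= t -> P t 0%N 0%N = 1) ->
  forall x t, 0 <= t -> 1 - P t x 0%N <= 2 * K0 * (1 - P t 1%N 0%N).
Proof.
move=> K1 HN Hstay H0 x T T0.
have TT : 0 <= T <= T by rewrite T0 lexx.
have P01 t k j := tf01 tP (t := t) k j.
have g0 t : 0 <= t -> 0 <= 1 - P t 1%N 0%N <= 1.
  by move=> t0; have := P01 t 1%N 0%N t0; lra.
suff : 1 - P T x 0%N - K0 * (1 - P T 1%N 0%N) * W x <= 0.
  rewrite subr_le0 => /le_trans; apply.
  rewrite [leRHS](_ : _ = K0 * (1 - P T 1%N 0%N) * 2); last by ring.
  rewrite ler_wpM2l//; last by have := W12 x; lra.
  by rewrite mulr_ge0//; [lra|case/andP: (g0 T T0)].
have ug0 t k : 0 <= t -> 0 <= K0 * (1 - P t 1%N 0%N) * W k.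
  move=> t0; have /andP[? ?] := g0 t t0; have := W12 k => ?.
  by rewrite !mulr_ge0//; lra.
apply: (max_principle q_ge0 c_ge0 q_lyapunov q_conservative (T := T)
  (G := (fun x => N < x)%N)
  (u := fun t x => 1 - P t x 0%N - K0 * (1 - P t 1%N 0%N) * W x)) => //.
- move=> {x} x t /andP[t0 _].
  by have := ug0 t x t0; have := P01 t x 0%N t0; lra.
- move=> {x} x _ t; apply: cvgB.
    by apply: cvgB; [exact: cvg_cst|exact: (tf_continuous tP qP)].
  apply: cvgM; last exact: cvg_cst.
  apply: cvgM; first exact: cvg_cst.
  by apply: cvgB; [exact: cvg_cst|exact: (tf_continuous tP qP)].
- move=> {x} x t /andP[t0 _] /negP; rewrite -leqNgt => xN.
  case: x xN => [|x] xN; first by rewrite H0//; have := ug0 t 0%N t0; lra.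
  have := HN x.+1 t xN t0 => /le_trans; rewrite subr_le0; apply.
  rewrite ler_peMr//; last by have := W12 x.+1; lra.
  by rewrite mulr_ge0//; [lra|case/andP: (g0 t t0)].
- move=> {x} [|x]; first by rewrite H0//; have := ug0 0 0%N (lexx 0); lra.
  rewrite !tf0//=.
  have W1 := W12 x.+1; have : 1 * 1 <= K0 * W x.+1 by rewrite ler_pM//; lra.
  by rewrite ?mulr0n ?subr0 ?mulr1; lra.
- move=> {x} x t K e Nx /andP[t0 _] xK e0.
  have e20 : 0 < e / 2 by rewrite divr_gt0.
  have K0_gt0 : 0 < K0 by lra.
  have e40 : 0 < e / (4 * K0) by rewrite divr_gt0// mulr_gt0.
  near=> h.
  have h0 : 0 < h by near: h; exact: nbhs_right_gt.
  have ht : h < t by near: h; exact: nbhs_right_lt.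
  have th0 : 0 <= t - h by rewrite subr_ge0 ltW.
  have : h * (\sum_(0 <= k < K) q x k * P t k 0%N - e / 2) <=
      P t x 0%N - P (t - h) x 0%N.
    near: h; apply: filterS (tf_backward tP qP 0%N t0 xK e20).
    by move=> h /andP[].
  have E1 : expR (lam * h) - 1 <= h * (lam + e / (4 * K0)).
    by near: h; exact: expR_sub1_near.
  (* The chain may stay at 1 during the first [h], so survival from 1 decays at rate at most [lam].
     The drift - lam W compensates exactly this, which makes the product a supersolution. *)
  have gth : 1 - P (t - h) 1%N 0%N <= expR (lam * h) * (1 - P t 1%N 0%N).
    have H1 : P h 1%N 1%N * (1 - P (t - h) 1%N 0%N) <= 1 - P t 1%N 0%N.
      have := ev_le_term (f := fun k => P (t - h) k 0%N) 1%N
        (tf_mass tP 1%N (ltW h0)) (fun k => P01 (t - h) k 0%N th0).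
      rewrite -tf_CK ?(ltW h0)// (addrC h) subrK; lra.
    have H2 : expR (- lam * h) * (1 - P (t - h) 1%N 0%N) <= 1 - P t 1%N 0%N.
      apply: le_trans H1; rewrite ler_wpM2r ?Hstay ?(ltW h0)//.
      by case/andP: (g0 _ th0).
    rewrite -(ler_pM2l (expR_gt0 (- lam * h))) [leRHS]mulrA -expRD.
    by rewrite mulNr addNr expR0 mul1r -mulNr.
  have -> : \sum_(0 <= k < K) q x k * (1 - P t k 0%N - K0 * (1 - P t 1%N 0%N) * W k) =
     \sum_(0 <= k < K) q x k - \sum_(0 <= k < K) q x k * P t k 0%N -
     K0 * (1 - P t 1%N 0%N) * (\sum_(0 <= k < K) q x k * W k).
    by rewrite !mulr_sumr -!sumrB; apply: eq_bigr => k _; ring.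
  have SW := sum_qW Nx xK; move: SW.
  set A := \sum_(0 <= k < K) q x k * P _ _ _.
  set B := \sum_(0 <= k < K) _ * _; set S := \sum_(0 <= k < K) _.
  move=> SW HP.
  have /andP[W1 W2] := W12 x; have /andP[g_ge0 g_le1] := g0 t (ltW t0).
  move: gth g_ge0 g_le1 E1; set g := 1 - P t 1%N 0%N.
  set H := expR _ => gth g_ge0 g_le1 E1.
  have KgW0 : 0 <= K0 * g * W x by rewrite !mulr_ge0//; lra.
  have gW2 : g * W x <= 2 by rewrite -[leRHS]mul1r ler_pM//; lra.
  have K2 : K0 * W x * (1 - P (t - h) 1%N 0%N) <= K0 * W x * (H * g).
    by rewrite ler_wpM2l// mulr_ge0//; lra.
  have K3 : K0 * g * W x * (H - 1) <= K0 * g * W x * (h * (lam + e / (4 * K0))).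
    by rewrite ler_wpM2l.
  have K4 : K0 * g * W x * (h * (lam + e / (4 * K0))) =
    h * lam * (K0 * g * W x) + h * (e / 4) * (g * W x) by field; lra.
  have K5 : h * (e / 4) * (g * W x) <= h * (e / 4) * 2.
    by rewrite ler_wpM2l// mulr_ge0 ?(ltW h0)//; lra.
  have K6 : h * (K0 * g * B) <= h * (K0 * g * (- lam * W x)).
    by rewrite ler_pM2l// ler_wpM2l// mulr_ge0//; lra.
  rewrite K4 in K3.
  lra.
Unshelve. all: by end_near. Qed.

End Generator.

(** * Contraction and existence of the quasi-stationary distribution *)

Section QuasiStationary.
Variables (R : realType) (P : R -> nat -> nat -> R).
Hypothesis tP : transition_function P.
Hypothesis P_absorb : forall t, 0 <= t -> P t 0%N 0%N = 1.
Hypothesis P_stay : forall t x, 0 <= t -> 0 < P t x x.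
Implicit Types (mu f : nat -> R) (t : R).

Let pos (k : nat) : R := (0 < k)%N%:R.

Definition killed t f x : R := ev (P t x) (fun k => pos k * f k).

Let one : nat -> R := fun=> 1.

Lemma pos01 k : 0 <= pos k <= 1.
Proof. by rewrite /pos; case: (0 < k)%N; rewrite ?lexx ?ler01. Qed.

Lemma one01 k : 0 <= one k <= 1. Proof. by rewrite lexx ler01. Qed.

Lemma posf01 f : (forall k, 0 <= f k <= 1) -> forall k, 0 <= pos k * f k <= 1.
Proof.
move=> f01 k; have := f01 k; rewrite /pos.
by case: (0 < k)%N; rewrite ?mul1r// mul0r lexx ler01.
Qed.

Lemma killed01 t f x : 0 <= t -> (forall k, 0 <= f k <= 1) ->
  0 <= killed t f x <= 1.
Proof. by move=> t0 f01; apply: ev01; [exact: tf_mass|exact: posf01]. Qed.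

Lemma killed_le t f x : 0 <= t -> (forall k, 0 <= f k <= 1) ->
  killed t f x <= killed t one x.
Proof.
move=> t0 f01; have := norm01 (posf01 f01); have := norm01 (posf01 one01).
move=> n1 n2; apply: ev_le n2 n1 _ => [|k]; first exact: tf_mass.
by have /andP[_ ?] := f01 k; rewrite /pos /one; case: (0 < k)%N; rewrite ?mul1r ?mul0r.
Qed.

Lemma killed_absorb t f : 0 <= t -> (forall k, 0 <= f k <= 1) ->
  killed t f 0%N = 0.
Proof.
move=> t0 f01; have /andP[k0 _] := killed01 0%N t0 f01.
apply/eqP; rewrite eq_le k0 andbT.
have := ev_le_term 0%N (tf_mass tP 0%N t0) (posf01 f01).
by rewrite P_absorb// /pos /= mul0r mulr0 subrr addr0.
Qed.

Lemma killed_pos t f k : 0 <= t -> (forall k, 0 <= f k <= 1) ->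
  pos k * killed t f k = killed t f k.
Proof.
move=> t0 f01; case: k => [|k]; rewrite /pos /= ?mul1r// mul0r.
by rewrite killed_absorb.
Qed.

Lemma killed_add s t f x : 0 <= s -> 0 <= t -> (forall k, 0 <= f k <= 1) ->
  killed (s + t) f x = killed s (killed t f) x.
Proof.
move=> s0 t0 f01; rewrite /killed (tf_CKf tP)//; last exact: posf01.
by congr (ev _ _); apply/funext => k; rewrite -[LHS]killed_pos.
Qed.

Lemma killed1E t x : 0 <= t -> killed t one x = 1 - P t x 0%N.
Proof.
move=> t0; have m := tf_mass tP x t0.
have d01 (k : nat) : 0 <= ((k == 0%N)%:R : R) <= 1.
  by case: (k == 0%N); rewrite ?lexx ?ler01.
have := ev_lin 1 (-1) m (norm01 one01) (norm01 d01).
rewrite (ev_delta _ m) (ev_cst 1 m) mulr1 mulN1r => <-.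
by congr (ev _ _); apply/funext => -[|k]; rewrite /pos /one /=; ring.
Qed.

Lemma killed1_gt0 t x : 0 <= t -> (0 < x)%N -> 0 < killed t one x.
Proof.
move=> t0 x0; apply: lt_le_trans (P_stay x t0) _.
have := ev_ge_term x (tf_mass tP x t0) (posf01 one01).
by rewrite /pos x0 !mulr1.
Qed.

(* Phi t mu f is the expectation of f (X_t) under P_mu given survival up to t. *)
Definition Phi t mu f : R := ev mu (killed t f) / ev mu (killed t one).

Definition pmass mu : Prop := mass mu /\ mu 0%N = 0.

Lemma ev_killed1_gt0 t mu : 0 <= t -> pmass mu -> 0 < ev mu (killed t one).
Proof.
move=> t0 [m mu0]; have [mu_ge0 mu1] := m.
have [k mk] : exists k, mu k != 0.
  apply: contrapT => /forallNP H; move: mu1; rewrite eseries0.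
    by move=> /eqP; rewrite eqe eq_sym oner_eq0.
  by move=> k _ _; have /negP := H k; rewrite negbK => /eqP ->.
have k0 : (0 < k)%N by rewrite lt0n; apply: contraNneq mk => ->; rewrite mu0.
apply: lt_le_trans (ev_ge_term k m (fun l => killed01 l t0 one01)).
by rewrite mulr_gt0 ?killed1_gt0// lt_neqAle eq_sym mk mu_ge0.
Qed.

Definition law t mu j : R := ev mu (fun k => P t k j) * pos j /
  ev mu (killed t one).

Lemma law_pmass t mu : 0 <= t -> pmass mu -> pmass (law t mu) /\
  forall f, (forall k, 0 <= f k <= 1) -> ev (law t mu) f = Phi t mu f.
Proof.
move=> t0 pm; have [m mu0] := pm.
have [mm mE] := ev_mix m (fun k => tf_mass tP k t0).
have z0 := ev_killed1_gt0 t0 pm.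
have E f : (forall k, 0 <= f k <= 1) ->
    ev (fun j => ev mu (fun k => P t k j)) (pos \* f) = ev mu (killed t f).
  by move=> f01; rewrite mE//; exact: posf01.
have zE : ev (fun j => ev mu (fun k => P t k j)) pos = ev mu (killed t one).
  by rewrite -E; [congr (ev _ _); apply/funext => k; rewrite /= mulr1|exact: one01].
have [lm lE] := ev_scale mm pos01 z0 zE.
split; first by split => //; rewrite /law /pos /= mulr0 mul0r.
by move=> f f01; rewrite lE// E.
Qed.

(** Markov property of the conditioned laws: the normalisation of [law s mu] cancels between
    numerator and denominator. *)
Lemma Phi_add s t mu f : 0 <= s -> 0 <= t -> pmass mu ->
  (forall k, 0 <= f k <= 1) -> Phi (s + t) mu f = Phi t (law s mu) f.
Proof.
move=> s0 t0 pm f01; have [_ lE] := law_pmass s0 pm.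
rewrite /Phi.
rewrite [in RHS]lE; last by move=> k; exact: killed01.
rewrite [in RHS]lE; last by move=> k; apply: killed01; [|exact: one01].
have E g : (forall k, 0 <= g k <= 1) ->
    ev mu (killed (s + t) g) = ev mu (killed s (killed t g)).
  by move=> g01; congr (ev _ _); apply/funext => k; exact: killed_add.
rewrite /Phi E// E; last exact: one01.
by rewrite -mulf_div mulfV ?mulr1// invr_eq0 gt_eqF// ev_killed1_gt0.
Qed.

(** * Geometric contraction of the conditioned laws and their fixed point *)

Variables (t0 c1 K : R).
Hypothesis t0_gt0 : 0 < t0.
Hypothesis c1_gt0 : 0 < c1.
Hypothesis minorization : forall x, (0 < x)%N -> c1 <= P t0 x 1%N.
Hypothesis survival_le : forall t x, 0 <= t ->
  1 - P t x 0%N <= K * (1 - P t 1%N 0%N).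

Lemma K_ge1 : 1 <= K.
Proof. by have := survival_le 1%N (lexx 0); rewrite !(tf0 tP) /= subr0 mulr1. Qed.

Lemma rate01 : 0 < c1 / K <= 1.
Proof.
have K1 := K_ge1; have K0 : 0 < K by apply: lt_le_trans K1.
rewrite divr_gt0//= ler_pdivrMr// mul1r; apply: le_trans K1.
apply: le_trans (minorization (ltnSn 0)) _.
by case/andP: (tf01 tP 1%N 1%N (ltW t0_gt0)).
Qed.

(* After a time t0 the oscillation of killed t f / killed t 1 shrinks by the
   factor 1 - c1 / K: both ends of its range move towards its value at 1. *)
Lemma killed_contract s n f : 0 <= s -> (forall k, 0 <= f k <= 1) ->
  exists m M : R, [/\ 0 <= m, M <= 1, m <= M, M - m <= (1 - c1 / K) ^+ n &
    forall x, m * killed (s + n%:R * t0) one x <= killed (s + n%:R * t0) f x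
      <= M * killed (s + n%:R * t0) one x].
Proof.
move=> s0 f01; elim: n => [|n [m [M [m0 M1 mM dM IH]]]].
  exists 0, 1; split; rewrite ?subr0 ?expr0 ?ler01// => x.
  rewrite mul0r mul1r mul0r addr0 killed_le// andbT.
  by case/andP: (killed01 x s0 f01).
set t := s + n%:R * t0 in IH.
have t_ge0 : 0 <= t by rewrite addr_ge0// mulr_ge0// ltW.
have tE : s + n.+1%:R * t0 = t0 + t by rewrite /t -natr1; ring.
pose A := killed t f; pose B := killed t one.
have A01 k : 0 <= A k <= 1 by exact: killed01.
have B01 k : 0 <= B k <= 1 by apply: killed01 => //; exact: one01.
have IH' k : m * B k <= A k <= M * B k by exact: IH.
have [c_gt0 c_le1] := andP rate01.
have K0 : 0 < K by apply: lt_le_trans K_ge1.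
have B1 : 0 < B 1%N by exact: killed1_gt0.
pose r := A 1%N / B 1%N.
have rB : r * B 1%N = A 1%N by rewrite /r divfK// gt_eqF.
have mr : m <= r by rewrite ler_pdivlMr//; case/andP: (IH' 1%N).
have rM : r <= M by rewrite ler_pdivrMr//; case/andP: (IH' 1%N).
exists (m + c1 / K * (r - m)), (M - c1 / K * (M - r)); split.
- by rewrite addr_ge0// mulr_ge0 ?(ltW c_gt0)// subr_ge0.
- by rewrite lerBlDr; apply: (le_trans M1); rewrite lerDl mulr_ge0 ?(ltW c_gt0)// subr_ge0.
- have : c1 / K * (M - m) <= M - m by rewrite ler_piMl// subr_ge0.
  lra.
- have -> : M - c1 / K * (M - r) - (m + c1 / K * (r - m)) = (1 - c1 / K) * (M - m) by ring.
  by rewrite exprS ler_wpM2l// subr_ge0.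
move=> [|x]; rewrite tE.
  have tt0 : 0 <= t0 + t by rewrite addr_ge0// ltW.
  by rewrite !killed_absorb// ?mulr0 ?lexx//; exact: one01.
have mx := tf_mass tP x.+1 (ltW t0_gt0).
have EE g : (forall k, 0 <= g k <= 1) ->
    killed (t0 + t) g x.+1 = ev (P t0 x.+1) (killed t g).
  move=> g01; rewrite killed_add ?(ltW t0_gt0)//.
  by congr (ev _ _); apply/funext => k; exact: killed_pos.
rewrite !EE//; last exact: one01.
rewrite -/A -/B.
(* The minorization yields a gain proportional to B at 1; the survival comparison turns it into a
   fraction 1 / K of the normalisation at x. *)
have EB : ev (P t0 x.+1) B <= K * B 1%N.
  rewrite -[leRHS](ev_cst _ mx); apply: (ev_le (D := `|K * B 1%N|) mx (norm01 B01)) => // k.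
  by rewrite /B !killed1E//; exact: survival_le.
(* Used for A - m B and M B - A, nonnegative by induction: of their expectation only the term at
   state 1 is kept. *)
have gap g (a b : R) : (forall k, 0 <= a * A k + b * B k <= 1) ->
    a * A 1%N + b * B 1%N = g * B 1%N -> 0 <= g ->
    c1 / K * g * ev (P t0 x.+1) B <= a * ev (P t0 x.+1) A + b * ev (P t0 x.+1) B.
  move=> h01 gE g0; rewrite -(ev_lin a b mx (norm01 A01) (norm01 B01)).
  apply: le_trans (ev_ge_term 1%N mx h01); rewrite gE.
  apply: (@le_trans _ _ (c1 * (g * B 1%N))); last first.
    by rewrite ler_wpM2r ?minorization// mulr_ge0// ltW.
  have -> : c1 * (g * B 1%N) = c1 / K * g * (K * B 1%N).
    by field; rewrite gt_eqF.
  by rewrite ler_wpM2l// mulr_ge0// ltW.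
apply/andP; split.
  have : c1 / K * (r - m) * ev (P t0 x.+1) B <=
     1 * ev (P t0 x.+1) A + - m * ev (P t0 x.+1) B.
    apply: gap; last by rewrite subr_ge0.
      move=> k; have := IH' k; have := A01 k; have /andP[b0 _] := B01 k.
      have := mulr_ge0 m0 b0; lra.
    by rewrite mulrBl rB; ring.
  lra.
have : c1 / K * (M - r) * ev (P t0 x.+1) B <=
   -1 * ev (P t0 x.+1) A + M * ev (P t0 x.+1) B.
  apply: gap; last by rewrite subr_ge0.
    move=> k; have := IH' k; have := A01 k; have /andP[b0 b1] := B01 k.
    have : M * B k <= 1 by rewrite mulr_ile1//; exact: le_trans m0 mM.
    lra.
  by rewrite mulrBl rB; ring.
lra.
Qed.

Definition theta t : R := (1 - c1 / K) ^+ Num.truncn (t / t0).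

(** Whatever the initial law, [Phi t mu f] is a weighted mean of the ratios of [killed t f] to
    [killed t one], hence lies in the interval of [killed_contract]. The part of [t] left over after
    whole steps [t0] goes into its [s]. *)
Lemma Phi_contract t mu nu f : 0 <= t -> pmass mu -> pmass nu ->
  (forall k, 0 <= f k <= 1) -> `|Phi t mu f - Phi t nu f| <= theta t.
Proof.
move=> t_ge0 pmu pnu f01; set n := Num.truncn (t / t0).
have tt0 : 0 <= t / t0 by rewrite divr_ge0// ltW.
have s0 : 0 <= t - n%:R * t0.
  rewrite subr_ge0 -ler_pdivlMr//.
  by case/andP: (truncn_itv tt0).
have [m [M [m0 M1 mM dM H]]] := killed_contract n s0 f01.
rewrite subrK in H.
have B rho : pmass rho -> m <= Phi t rho f <= M.
  move=> pr; have [mr _] := pr; have z0 := ev_killed1_gt0 t_ge0 pr.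
  have k1 := norm01 (fun k => killed01 k t_ge0 one01).
  have kf := norm01 (fun k => killed01 k t_ge0 f01).
  have lin a : ev rho (fun k => a * killed t one k) = a * ev rho (killed t one).
    have := ev_lin a 0 mr k1 k1; rewrite mul0r addr0 => <-.
    by congr (ev _ _); apply/funext => k; rewrite mul0r addr0.
  have bnd a k : `|a * killed t one k| <= `|a|.
    by rewrite normrM ler_piMr.
  rewrite /Phi ler_pdivlMr// ler_pdivrMr// -!lin; apply/andP; split.
    by apply: ev_le mr (bnd m) kf _ => k; case/andP: (H k).
  by apply: ev_le mr kf (bnd M) _ => k; case/andP: (H k).
apply: le_trans dM; rewrite ler_norml.
by have := B mu pmu; have := B nu pnu; lra.
Qed.

(** 1 - r <= e^{-r} for r = c1 / K; rounding t / t0 down loses at most one step, whence the factor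
    e^r. *)
Lemma theta_le t : 0 <= t ->
  theta t <= expR (c1 / K) * expR (- (c1 / K / t0) * t).
Proof.
move=> t_ge0; have [c_gt0 c_le1] := andP rate01.
have tt0 : 0 <= t / t0 by rewrite divr_ge0// ltW.
apply: (@le_trans _ _ (expR (- (c1 / K)) ^+ Num.truncn (t / t0))).
  rewrite lerXn2r ?nnegrE ?expR_ge0// ?subr_ge0//.
  exact: expR_ge1Dx.
rewrite -expRM_natl -expRD ler_expR.
have /andP[_] := truncn_itv tt0; rewrite -natr1 => H.
have : c1 / K * (t / t0) <= c1 / K * ((Num.truncn (t / t0))%:R + 1).
  by rewrite ler_pM2l// ltW.
have -> : - (c1 / K / t0) * t = - (c1 / K * (t / t0)) 
  by field; rewrite !gt_eqF// (lt_le_trans _ K_ge1).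
lra.
Qed.

Lemma theta_cvg0 : (fun n => theta n%:R) @ \oo --> (0 : R).
Proof.
have [c_gt0 c_le1] := andP rate01.
have K0 : 0 < K by apply: lt_le_trans K_ge1.
have theta0 t : 0 <= theta t by rewrite exprn_ge0// subr_ge0.
pose g := expR (- (c1 / K / t0)).
have g1 : `|g| < 1.
  by rewrite ger0_norm ?expR_ge0// -expR0 ltr_expR oppr_lt0 !divr_gt0.
apply: (@squeeze_cvgr _ _ _ _ (fun=> 0) (fun n => expR (c1 / K) * g ^+ n)).
- apply: nearW => n; rewrite theta0/=.
  by apply: (le_trans (theta_le _)) => //; rewrite /g -expRM_natl (mulrC n%:R).
- exact: cvg_cst.
- rewrite -[X in _ --> X](mulr0 (expR (c1 / K))).
  by apply: cvgM; [exact: cvg_cst|exact: cvg_expr].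
Qed.

Lemma exists_qsd : exists2 pi, pmass pi &
  forall t f, 0 <= t -> (forall k, 0 <= f k <= 1) -> Phi t pi f = ev pi f.
Proof.
pose d1 (k : nat) : R := (k == 1%N)%:R.
have p1 : pmass d1.
  split => //; have -> : d1 = P 0 1%N.
    by apply/funext => k; rewrite (tf0 tP) eq_sym.
  exact: tf_mass.
pose l (n : nat) := law n%:R d1.
have lm n : pmass (l n) by case: (law_pmass (ler0n _ n) p1).
have lE n f : (forall k, 0 <= f k <= 1) -> ev (l n) f = Phi n%:R d1 f.
  by case: (law_pmass (ler0n _ n) p1) => _; exact.
(* Running time [t] after [n] is the same as running time [n] from [law t d1], so the contraction
   over time [n] applies. *)
have lD n t f : 0 <= t -> (forall k, 0 <= f k <= 1) ->
    `|ev (l n) f - Phi t (l n) f| <= theta n%:R.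
  move=> t_ge0 f01; rewrite lE// -Phi_add// (addrC n%:R t) Phi_add//.
  by apply: Phi_contract => //; case: (law_pmass t_ge0 p1).
have cau n m f : (n <= m)%N -> (forall k, 0 <= f k <= 1) ->
    `|ev (l n) f - ev (l m) f| <= theta n%:R.
  move=> nm f01; have := lD n (m - n)%:R f (ler0n _ _) f01.
  have mE : m%:R = n%:R + (m - n)%:R :> R by rewrite -natrD subnKC.
  by rewrite [ev (l m) f]lE// mE Phi_add.
have [pi mpi piE] := mass_limit (fun n => proj1 (lm n)) theta_cvg0 cau.
have evpi f : (forall k, 0 <= f k <= 1) -> (fun n => ev (l n) f) @ \oo --> ev pi f.
  move=> f01; apply/cvgrPdist_le => e e0.
  have /cvgrPdist_lt /(_ e e0) := theta_cvg0; apply: filterS => n.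
  rewrite sub0r normrN => /ltW /(le_trans (ler_norm _)) th.
  by rewrite distrC; apply: le_trans th; exact: piE.
have ppi : pmass pi.
  split=> //.
  have d01 (k : nat) : 0 <= ((k == 0%N)%:R : R) <= 1.
    by case: (k == 0%N); rewrite ?lexx ?ler01.
  have := evpi _ d01; rewrite (ev_delta _ mpi).
  under eq_fun do rewrite (ev_delta _ (proj1 (lm _))) (proj2 (lm _)).
  by move=> /cvg_lim <-//; rewrite lim_cst.
exists pi => // t f t_ge0 f01.
(* The same sequence tends to both sides: by continuity of numerator and denominator, and by
   [lD]. *)
have c1' : (fun n => Phi t (l n) f) @ \oo --> Phi t pi f.
  apply: cvgM; first by apply: evpi => k; exact: killed01.
  apply: cvgV; first by rewrite gt_eqF// ev_killed1_gt0.
  by apply: evpi => k; apply: killed01 => //; exact: one01.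
have c2 : (fun n => Phi t (l n) f) @ \oo --> ev pi f.
  have H : (fun n => ev (l n) f - (ev (l n) f - Phi t (l n) f)) @ \oo --> ev pi f - 0.
    apply: cvgB; first exact: evpi.
    apply/cvgrPdist_le => e e0.
    have /cvgrPdist_lt /(_ e e0) := theta_cvg0; apply: filterS => n.
    rewrite !sub0r !normrN => /ltW /(le_trans (ler_norm _)); apply: le_trans.
    exact: lD.
  rewrite subr0 in H.
  rewrite (_ : (fun n => Phi t (l n) f) = fun n => ev (l n) f - (ev (l n) f - Phi t (l n) f))//.
  by apply/funext => n; rewrite subKr.
by rewrite -(cvg_lim _ c1')// (cvg_lim _ c2).
Qed.

End QuasiStationary.

(** * The rates of the controlled chain *)

(* A bounded function whose increment over [n - 1, n] is of order n^{-1-a}. *)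
Definition lyap (R : realType) (a : R) (n : nat) : R :=
  2 - expR (- a * ln n.+1%:R).

Section Lyapunov.
Variables (R : realType) (a : R).
Hypothesis a_gt0 : 0 < a.

Lemma lyap12 n : 1 <= lyap a n <= 2.
Proof.
have z0 := expR_gt0 (- a * ln n.+1%:R).
have : expR (- a * ln n.+1%:R) <= 1.
  by rewrite -[leRHS]expR0 ler_expR mulNr oppr_le0 mulr_ge0 ?(ltW a_gt0)// ln_ge0 ?ler1n.
by rewrite /lyap; lra.
Qed.

(** From 1 - e^{-y} <= y with y = a ln (1 + j / (n + 1)), and ln (1 + u) <= u. *)
Lemma lyap_up n j : lyap a (n + j) - lyap a n <= a * j%:R / n.+1%:R.
Proof.
have n0 : 0 < n.+1%:R :> R by rewrite ltr0n.
have z0 := expR_gt0 (- a * ln n.+1%:R : R).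
have z1 : expR (- a * ln n.+1%:R) <= 1 :> R by have := lyap12 n; rewrite /lyap; lra.
have [y yE] : exists y, y = a * (ln (n + j).+1%:R - ln n.+1%:R) by eexists.
have E : expR (- a * ln (n + j).+1%:R) = expR (- a * ln n.+1%:R) * expR (- y).
  by rewrite -expRD yE; congr expR; ring.
have y_le : y <= a * j%:R / n.+1%:R.
  rewrite yE -mulrA ler_pM2l// -ln_div ?posrE ?ltr0n//.
  have -> : (n + j).+1%:R / n.+1%:R = 1 + j%:R / n.+1%:R :> R.
    by rewrite -addSn natrD mulrDl divff// gt_eqF.
  by apply: le_ln1Dx; apply: (@lt_le_trans _ _ 0); rewrite ?ltrN10// divr_ge0.
have y0 : 0 <= y.
  rewrite yE mulr_ge0 ?(ltW a_gt0)// subr_ge0 ler_ln ?posrE ?ltr0n//.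
  by rewrite ler_nat ltnS leq_addr.
rewrite /lyap E; apply: le_trans y_le.
have /= e1 := expR_ge1Dx (- y).
set z := expR (- a * _) in z0 z1 *.
have : z * (1 - expR (- y)) <= 1 * y.
  rewrite ler_pM// ?(ltW z0)//; last by lra.
  by rewrite subr_ge0 -[leRHS]expR0 ler_expR; lra.
lra.
Qed.

(** The left-hand side is a (2n)^{-1-a}: the increment is at least a (n + 1)^{-1-a}, and n + 1 <=
    2n. *)
Lemma lyap_down n : (0 < n)%N ->
  a * expR (- (1 + a) * (ln 2 + ln n%:R)) <= lyap a n - lyap a n.-1.
Proof.
case: n => // n _ /=; rewrite /lyap.
have n0 : 0 < n.+1%:R :> R by rewrite ltr0n.
have n20 : 0 < n.+2%:R :> R by rewrite ltr0n.
have [y yE] : exists y, y = a * (ln n.+2%:R - ln n.+1%:R) by eexists.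
have E : expR (- a * ln n.+1%:R) = expR (- a * ln n.+2%:R) * expR y.
  by rewrite -expRD yE; congr expR; ring.
have y_ge : a / n.+2%:R <= y.
  rewrite yE ler_pM2l// -(opprB (ln n.+1%:R)) lerNr -ln_div ?posrE//.
  have -> : n.+1%:R / n.+2%:R = 1 + (- n.+2%:R^-1) :> R.
    have -> : n.+1%:R = n.+2%:R - 1 :> R by rewrite -(natr1 n.+1) addrK.
    by rewrite mulrBl divff ?gt_eqF// div1r.
  apply: le_ln1Dx; rewrite ltrN2 invf_lt1//.
  by rewrite ltr1n.
rewrite E.
have e1 := expR_ge1Dx y.
have z0 := expR_gt0 (- a * ln n.+2%:R).
apply: (@le_trans _ _ (expR (- a * ln n.+2%:R) * (a / n.+2%:R))); last first.
  have : expR (- a * ln n.+2%:R) * (a / n.+2%:R) <= expR (- a * ln n.+2%:R) * (expR y - 1).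
    by rewrite ler_pM2l// lerBrDl; apply: le_trans e1; rewrite lerD2l.
  move=> H; apply: (le_trans H); rewrite [leRHS](_ : _ = expR (- a * ln n.+2%:R) * (expR y - 1)) //.
  by ring.
rewrite mulrCA ler_pM2l//.
have -> : expR (- a * ln n.+2%:R) / n.+2%:R = expR (- (1 + a) * ln n.+2%:R).
  rewrite -{2}(lnK n20) -expRN -expRD; congr expR; ring.
rewrite ler_expR !mulNr lerN2 ler_pM2l; last by rewrite addr_gt0.
rewrite -lnM ?posrE// ler_ln ?posrE ?mulr_gt0//.
by rewrite -natrM ler_nat mul2n -addnn addSn addnS !ltnS leq_addl.
Qed.

End Lyapunov.

(** * Truncated row sums of the birth and death rates *)

Section BirthDeath.
Variables (R : realType) (A : Type) (b d : nat -> A -> R).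
Variables (p : nat -> nat -> A -> R).
Hypothesis b_ge0 : forall n a, 0 <= b n a.
Hypothesis d_ge0 : forall n a, 0 <= d n a.
Hypothesis p_ge0 : forall n k a, (0 < k)%N -> 0 <= p n k a.
Hypothesis p_sum1 : forall n a, (\sum_(1 <= k <oo) (p n k a)%:E = 1)%E.
Hypothesis b0 : forall a, b 0%N a = 0.
Hypothesis d0 : forall a, d 0%N a = 0.
Variables (bbar M : R) (dbar : nat -> R).
Hypothesis bbar_gt0 : 0 < bbar.
Hypothesis b_le : forall n a, b n a <= bbar * n%:R.
Hypothesis M_gt0 : 0 < M.
Hypothesis p_mean : forall n a, (\sum_(1 <= k <oo) (k%:R * p n k a)%:E <= M%:E)%E.

Lemma p_sum_le1 n a J : \sum_(1 <= j < J) p n j a <= 1.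
Proof.
rewrite -lee_fin -(p_sum1 n a) -sumEFin; apply: nneseries_lim_ge => j j1 _.
by rewrite lee_fin p_ge0.
Qed.

Lemma p_mean_le n a J : \sum_(1 <= j < J) p n j a * j%:R <= M.
Proof.
rewrite -lee_fin; apply: le_trans (p_mean n a); rewrite -sumEFin.
under eq_bigr do rewrite mulrC.
by apply: nneseries_lim_ge => j j1 _; rewrite lee_fin mulr_ge0// p_ge0.
Qed.

Lemma p_sum_near1 n a e : 0 < e -> exists J, 1 - e <= \sum_(1 <= j < J) p n j a.
Proof.
move=> e0; apply: contrapT => /forallNP H.
suff : ((1 : R)%:E <= (1 - e)%:E)%E by rewrite lee_fin; lra.
rewrite -(p_sum1 n a); apply: lime_le.
  by apply: is_cvg_nneseries => j j1 _; rewrite lee_fin p_ge0.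
apply: nearW => J; rewrite sumEFin lee_fin.
by have /negP := H J; rewrite -ltNge => /ltW.
Qed.

Variable alpha : nat -> A.
Let q := bd_rate b d p alpha.

(** The generator applied to [f], with births beyond [K] removed but the diagonal kept whole. At x =
    0, where [x.-1] is 0, the death term vanishes. *)
Lemma bd_sum (f : nat -> R) x K : (x < K)%N ->
  \sum_(0 <= k < K) q x k * f k =
  d x (alpha x) * (f x.-1 - f x) +
  b x (alpha x) * (\sum_(1 <= j < K - x) p x j (alpha x) * f (x + j)%N - f x).
Proof.
move=> xK; rewrite (@big_cat_nat _ _ _ x)//= ?(ltnW xK)// (@big_ltn _ _ _ x K)//.
have -> : \sum_(x.+1 <= k < K) q x k * f k =
    b x (alpha x) * \sum_(1 <= j < K - x) p x j (alpha x) * f (x + j)%N.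
  rewrite mulr_sumr -{1}(addn1 x) (addnC x) big_addn.
  apply: eq_big_nat => j /andP[j1 _]; rewrite /q /bd_rate.
  by rewrite -[X in (X < _)%N]add0n ltn_add2r j1 addnK mulrA (addnC x).
have -> : \sum_(0 <= k < x) q x k * f k = d x (alpha x) * f x.-1.
  case: x {xK} => [|x]; first by rewrite big_geq// d0 mul0r.
  rewrite big_nat_recr//= big_nat big1 ?add0r.
    by rewrite /q /bd_rate ltnNge leqnSn /= eqxx.
  move=> k /= kx; rewrite /q /bd_rate.
  by rewrite ltnNge (leq_trans (ltnW kx))//= eqSS gtn_eqF// gtn_eqF ?mul0r// leqW.
by rewrite /q /bd_rate ltnn eqn_leq ltnn andbF eqxx; ring.
Qed.

Lemma bd_sum1 x K : (x < K)%N -> \sum_(0 <= k < K) q x k =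
  - (b x (alpha x) * (1 - \sum_(1 <= j < K - x) p x j (alpha x))).
Proof.
move=> xK; have := bd_sum (fun=> 1) xK.
under eq_bigr do rewrite mulr1.
under [in RHS]eq_bigr do rewrite mulr1.
by move=> ->; ring.
Qed.

Lemma bd_ge0 x k : x != k -> 0 <= q x k.
Proof.
rewrite /q /bd_rate; case: ltnP => [xk _|kx nxk].
  by rewrite mulr_ge0// p_ge0// subn_gt0.
by rewrite (negbTE nxk); case: ifP.
Qed.

Lemma bd_sum_le0 x K : (x < K)%N -> \sum_(0 <= k < K) q x k <= 0.
Proof.
by move=> xK; rewrite bd_sum1// oppr_le0 mulr_ge0// subr_ge0 p_sum_le1.
Qed.

Lemma bd_conservative x e : 0 < e ->
  exists2 K, (x < K)%N & - \sum_(0 <= k < K) q x k <= e.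
Proof.
move=> e0; have b1 : 0 < b x (alpha x) + 1 by rewrite ltr_wpDl.
have e1 : 0 < e / (b x (alpha x) + 1) by rewrite divr_gt0.
have [J HJ] := p_sum_near1 x (alpha x) e1.
have xK : (x < x + J.+1)%N by rewrite addnS ltnS leq_addr.
exists (x + J.+1)%N => //; rewrite bd_sum1// opprK addKn.
have HJ' : 1 - e / (b x (alpha x) + 1) <= \sum_(1 <= j < J.+1) p x j (alpha x).
  case: J HJ {xK} => [|J] HJ; first by move: HJ; rewrite !big_geq.
  by apply: (le_trans HJ); rewrite [leRHS]big_nat_recr//= lerDl p_ge0.
apply: (@le_trans _ _ (b x (alpha x) * (e / (b x (alpha x) + 1)))).
  by rewrite ler_wpM2l//; lra.
by rewrite mulrA ler_pdivrMr// mulrC ler_pM2l// lerDl.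
Qed.

(** Deaths lower k + 1, births raise it at mean rate at most b M <= bbar M x, and truncation only
    lowers the sum. *)
Lemma bd_lyapunov x K : (x < K)%N ->
  \sum_(0 <= k < K) q x k * (k%:R + 1) <= bbar * M * (x%:R + 1).
Proof.
move=> xK; rewrite (bd_sum (fun k => k%:R + 1) xK).
set B := b x _; set D := d x _.
have S1 := p_sum_le1 x (alpha x) (K - x).
have SM := p_mean_le x (alpha x) (K - x).
have -> : \sum_(1 <= j < K - x) p x j (alpha x) * ((x + j)%:R + 1) =
    (x%:R + 1) * \sum_(1 <= j < K - x) p x j (alpha x) +
    \sum_(1 <= j < K - x) p x j (alpha x) * j%:R.
  by rewrite mulr_sumr -big_split; apply: eq_bigr => j _; rewrite /= natrD; ring.
set S := \sum_(_ <= _ < _) _ in S1 *; set S' := \sum_(_ <= _ < _) _ in SM *.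
have B0 : 0 <= B := b_ge0 _ _; have D0 : 0 <= D := d_ge0 _ _.
have xR : 0 <= x%:R :> R by [].
have H1 : (x%:R + 1) * S <= (x%:R + 1) * 1 by rewrite ler_wpM2l// addr_ge0.
have H2 : B * ((x%:R + 1) * S + S' - (x%:R + 1)) <= B * M by rewrite ler_wpM2l//; lra.
have H3 : B * M <= bbar * x%:R * M by rewrite ler_wpM2r ?(ltW M_gt0)// b_le.
have H4 : D * (x.-1%:R + 1 - (x%:R + 1)) <= 0.
  by rewrite mulr_ge0_le0// opprD addrACA subrr addr0 subr_le0 ler_nat leq_pred.
have : 0 < bbar * M by rewrite mulr_gt0.
lra.
Qed.

Lemma bd_skipfree x : (1 < x)%N -> q x 0%N = 0.
Proof. by case: x => [|[|x]]. Qed.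

Variables (eps dlow lam : R).
Hypothesis eps_gt0 : 0 < eps.
Hypothesis dlow_gt0 : 0 < dlow.
Hypothesis d_ge : forall n a, dlow * (n%:R `^ (1 + eps)) <= d n a.
Hypothesis lam_gt0 : 0 < lam.

(** With a = eps / 2, births contribute at most bbar M a and deaths at most - dlow a 2^{-1-a} x^a.
    The condition on [N] makes deaths win by 2 lam, which is at least lam W. *)
Lemma bd_drift N : (0 < N)%N ->
    (bbar * M * (eps / 2) + 2 * lam) /
      (dlow * (eps / 2) * expR (- (1 + eps / 2) * ln 2)) <= expR (eps / 2 * ln N%:R) ->
  forall x K, (N < x)%N -> (x < K)%N ->
  \sum_(0 <= k < K) q x k * (lyap (eps / 2) k - lyap (eps / 2) x) <=
  - lam * lyap (eps / 2) x.
Proof.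
set a := eps / 2 => N0 HN x K Nx xK.
have a0 : 0 < a by rewrite divr_gt0.
have x0 : (0 < x)%N by exact: leq_trans Nx.
have xR : 0 < x%:R :> R by rewrite ltr0n.
rewrite (bd_sum (fun k => lyap a k - lyap a x) xK) subrr !subr0.
set B := b x _; set D := d x _.
have birth : B * (\sum_(1 <= j < K - x) p x j (alpha x) * (lyap a (x + j) - lyap a x)) <=
    bbar * M * a.
  apply: (@le_trans _ _ (B * (a / x.+1%:R * M))).
    rewrite ler_wpM2l ?b_ge0//.
    apply: (@le_trans _ _ (a / x.+1%:R * \sum_(1 <= j < K - x) p x j (alpha x) * j%:R)).
      rewrite mulr_sumr; apply: ler_sum_nat => j /andP[j1 _].
      rewrite mulrCA ler_wpM2l ?p_ge0//.
      by have := lyap_up a0 x j; rewrite mulrAC.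
    by rewrite ler_wpM2l ?p_mean_le// divr_ge0// ltW.
  apply: (@le_trans _ _ (bbar * x.+1%:R * (a / x.+1%:R * M))).
    apply: ler_wpM2r; first exact: mulr_ge0 (divr_ge0 (ltW a0) (ler0n _ _)) (ltW M_gt0).
    by apply: (le_trans (b_le _ _)); rewrite ler_pM2l// ler_nat.
  have : x.+1%:R != 0 :> R by rewrite pnatr_eq0.
  move: (x.+1%:R : R) => y y0.
  by rewrite [leLHS](_ : _ = bbar * M * a) //; field.
have death : bbar * M * a + 2 * lam <= D * (lyap a x - lyap a x.-1).
  apply: (@le_trans _ _ (dlow * x%:R `^ (1 + eps) *
      (a * expR (- (1 + a) * (ln 2 + ln x%:R))))); last first.
    rewrite ler_pM ?d_ge ?lyap_down//.
      by rewrite mulr_ge0 ?powR_ge0// ltW.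
    by rewrite mulr_ge0 ?expR_ge0// ltW.
  rewrite /powR pnatr_eq0 (gtn_eqF x0).
  have -> : dlow * expR ((1 + eps) * ln x%:R) *
      (a * expR (- (1 + a) * (ln 2 + ln x%:R))) =
      expR (a * ln x%:R) * (dlow * a * expR (- (1 + a) * ln 2)).
    have E : expR ((1 + eps) * ln x%:R) * expR (- (1 + a) * (ln 2 + ln x%:R)) =
        expR (a * ln x%:R) * expR (- (1 + a) * ln 2).
      by rewrite -!expRD; congr expR; rewrite /a; field.
    transitivity (dlow * a * (expR ((1 + eps) * ln x%:R) *
      expR (- (1 + a) * (ln 2 + ln x%:R)))); first by ring.
    by rewrite E; ring.
  have c0 : 0 < dlow * a * expR (- (1 + a) * ln 2).
    by rewrite !mulr_gt0// expR_gt0.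
  rewrite -ler_pdivrMr//; apply: (le_trans HN).
  rewrite ler_expR ler_pM2l// ler_ln ?posrE ?ltr0n//.
  by rewrite ler_nat ltnW.
have /andP[_ W2] := lyap12 a0 x.
have : lam * lyap a x <= lam * 2 by rewrite ler_pM2l.
lra.
Qed.

End BirthDeath.

Lemma expR_ln_large (R : realType) (a Y : R) : 0 < a ->
  exists2 N, (0 < N)%N & Y <= expR (a * ln N%:R).
Proof.
move=> a0; exists (Num.truncn (expR (Y / a))).+1 => //.
apply: (@le_trans _ _ (expR Y)).
  by apply: le_trans (expR_ge1Dx Y); rewrite lerDr.
rewrite ler_expR mulrC -ler_pdivrMr// -ler_expR lnK ?posrE ?ltr0n//.
exact/ltW/truncnS_gt.
Qed.

Lemma finite_lower_bound (R : realType) (m : nat -> R) N :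
  (forall x, (0 < x)%N -> 0 < m x) ->
  exists2 e, 0 < e <= 1 & forall x, (0 < x <= N)%N -> e <= m x.
Proof.
move=> m0; elim: N => [|N [e /andP[e0 e1] He]].
  by exists 1; rewrite ?ltr01 ?lexx// => x /andP[x0]; rewrite leqNgt x0.
exists (Num.min e (m N.+1)); first by rewrite lt_min e0 m0//= ge_min e1.
move=> x /andP[x0]; rewrite leq_eqVlt => /orP[/eqP ->|xN].
  by rewrite ge_min lexx orbT.
by rewrite ge_min He// x0.
Qed.

(** * Constants independent of the control *)

Section UniformBounds.
Variables (R : realType) (A : Type) (b d : nat -> A -> R).
Variables (p : nat -> nat -> A -> R).
Hypothesis b_ge0 : forall n a, 0 <= b n a.
Hypothesis d_ge0 : forall n a, 0 <= d n a.
Hypothesis p_ge0 : forall n k a, (0 < k)%N -> 0 <= p n k a.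
Hypothesis p_sum1 : forall n a, (\sum_(1 <= k <oo) (p n k a)%:E = 1)%E.
Hypothesis b0 : forall a, b 0%N a = 0.
Hypothesis d0 : forall a, d 0%N a = 0.
Variables (bbar M eps dlow : R) (dbar : nat -> R).
Hypothesis bbar_gt0 : 0 < bbar.
Hypothesis b_le : forall n a, b n a <= bbar * n%:R.
Hypothesis dbar_ge0 : forall n, 0 <= dbar n.
Hypothesis d_le : forall n a, d n a <= dbar n.
Hypothesis M_gt0 : 0 < M.
Hypothesis p_mean : forall n a, (\sum_(1 <= k <oo) (k%:R * p n k a)%:E <= M%:E)%E.
Hypothesis eps_gt0 : 0 < eps.
Hypothesis dlow_gt0 : 0 < dlow.
Hypothesis d_ge : forall n a, dlow * (n%:R `^ (1 + eps)) <= d n a.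

Lemma bd_unique alpha P P' :
  transition_function P -> has_rates (bd_rate b d p alpha) P ->
  transition_function P' -> has_rates (bd_rate b d p alpha) P' ->
  forall t x j, 0 <= t -> P t x j = P' t x j.
Proof.
apply: (@tf_unique _ _ (bbar * M)).
- by move=> x k; exact: bd_ge0.
- by rewrite mulr_ge0// ltW.
- by move=> x K; exact: bd_lyapunov.
- by move=> x e; exact: bd_conservative.
Qed.

Lemma bd_stay alpha P t x :
  transition_function P -> has_rates (bd_rate b d p alpha) P -> 0 <= t ->
  0 < P t x x.
Proof.
move=> tP qP t0; apply: lt_le_trans (tf_stay tP qP _ t0); first exact: expR_gt0.
by rewrite -subr_gt0 opprK; instantiate (1 := - bd_rate b d p alpha x x + 1); lra.
Qed.

Lemma bd_absorb alpha P t :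
  transition_function P -> has_rates (bd_rate b d p alpha) P -> 0 <= t ->
  P t 0%N 0%N = 1.
Proof.
move=> tP qP t0; apply/eqP; rewrite eq_le.
have /andP[_ ->] := tf01 tP 0%N 0%N t0; rewrite /= leNgt; apply/negP => lt1.
(* The exit rate at 0 is 0, so [tf_stay] applies with any e > 0; this one gives 1 - P_t(0,0) <= e t
   < e (t + 1) = 1 - P_t(0,0). *)
pose e := (1 - P t 0%N 0%N) / (t + 1).
have t1 : 0 < t + 1 by rewrite ltr_wpDl.
have e0 : 0 < e by rewrite divr_gt0// subr_gt0.
have q0 : - bd_rate b d p alpha 0 0 < e by rewrite /bd_rate /= b0 d0 addr0 !oppr0.
have := tf_stay tP qP q0 t0; have := expR_ge1Dx (- e * t).
have : e * (t + 1) = 1 - P t 0%N 0%N by rewrite /e divfK// gt_eqF.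
lra.
Qed.

Lemma bd_uniform (m : nat -> nat -> R) :
  (forall y z, (0 < y)%N -> (0 < z)%N -> 0 < m y z) ->
  exists t0 c1 K : R, [/\ 0 < t0, 0 < c1, 0 < K & forall alpha P,
    transition_function P -> has_rates (bd_rate b d p alpha) P ->
    (forall y z, (0 < y)%N -> (0 < z)%N -> m y z <= P 1 y z) ->
    (forall x, (0 < x)%N -> c1 <= P t0 x 1%N) /\
    (forall t x, 0 <= t -> 1 - P t x 0%N <= K * (1 - P t 1%N 0%N))].
Proof.
(* Exceeds the exit rate from 1 under every control. *)
move=> m_gt0; pose lam := bbar + dbar 1%N + 1.
have lam_gt0 : 0 < lam by rewrite /lam ltr_wpDl// addr_ge0// ltW.
have a_gt0 : 0 < eps / 2 by rewrite divr_gt0.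
have [N N0 HN] := expR_ln_large ((bbar * M * (eps / 2) + 2 * lam) /
  (dlow * (eps / 2) * expR (- (1 + eps / 2) * ln 2))) a_gt0.
have [e1 /andP[e1_gt0 e1_le1] He1] := finite_lower_bound N
  (fun x x0 => m_gt0 x 1%N x0 (ltnSn 0)).
have [e2 /andP[e2_gt0 e2_le1] He2] := finite_lower_bound N
  (fun x => m_gt0 1%N x (ltnSn 0)).
(* Chosen so that e^{-lam T} <= 1/4, which keeps 1 - 2 e^{-lam T} at least 1/2. *)
pose T := 3 / lam.
have T0 : 0 <= T by rewrite divr_ge0// ltW.
have lamT : - lam * T = - 3 by rewrite /T mulrC mulrN divfK// gt_eqF.
(* Reach 1 at time 1 from a state up to [N], then stay there for a time up to [T]. *)
pose delta := e1 * expR (- lam * T).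
have delta_gt0 : 0 < delta by rewrite mulr_gt0// expR_gt0.
have E3 : expR (- lam * T) <= 1 / 4.
  rewrite lamT expRN -[leLHS]div1r ler_pdivrMr ?expR_gt0//.
  by have := expR_ge1Dx (3 : R); lra.
have delta_le1 : delta <= 1.
  by rewrite mulr_ile1 ?expR_ge0// ?(ltW e1_gt0)//; lra.
(* The last constant is 2 K0 of [tf_survival_le] with K0 = 1 / e2. *)
exists (T + 1), (delta * (1 - 2 * expR (- lam * T))), (2 * e2^-1); split.
- by rewrite ltr_wpDl.
- by rewrite mulr_gt0//; lra.
- by rewrite mulr_gt0// invr_gt0.
move=> alpha P tP qP mP.
have stay t : 0 <= t -> expR (- lam * t) <= P t 1%N 1%N.
  move=> t0; apply: (tf_stay tP qP) => //.
  rewrite /bd_rate ltnn /= opprK /lam.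
  have := b_le 1%N (alpha 1%N); have := d_le 1%N (alpha 1%N); lra.
have P01 t k j := tf01 tP (t := t) k j.
have cM : 0 <= bbar * M by rewrite mulr_ge0// ltW.
split.
- apply: (tf_minorization (c := bbar * M) (W := lyap (eps / 2)) (N := N)
    (q := bd_rate b d p alpha) _ _ _ _ _ tP qP) => //.
  + by move=> x k; exact: bd_ge0.
  + by move=> x K; exact: bd_lyapunov.
  + by move=> x K; exact: bd_sum_le0.
  + by move=> x e; exact: bd_conservative.
  + by move=> k; exact: lyap12.
  + by move=> x; exact: bd_skipfree.
  + by move=> x K; exact: (bd_drift b_ge0 p_ge0 d0 bbar_gt0 b_le M_gt0 p_mean
      alpha eps_gt0 dlow_gt0 d_ge lam_gt0 N0 HN).
  + by rewrite (ltW delta_gt0).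
  + move=> x t xN /andP[t0 tT]; rewrite addrC.
    apply: le_trans (tf_mul tP x 1%N 1%N ler01 t0).
    rewrite /delta ler_pM ?(ltW e1_gt0) ?expR_ge0//.
      by apply: le_trans (He1 x xN) _; rewrite mP//; case/andP: xN.
    apply: le_trans (stay t t0); rewrite ler_expR !mulNr lerN2.
    by rewrite ler_pM2l.
- move=> t x t0; apply: (tf_survival_le (c := bbar * M) (W := lyap (eps / 2)) (N := N)
    (lam := lam) (q := bd_rate b d p alpha) _ _ _ _ _ tP qP) => //.
  + by move=> y k; exact: bd_ge0.
  + by move=> y K; exact: bd_lyapunov.
  + by move=> y K; exact: bd_sum_le0.
  + by move=> y e; exact: bd_conservative.
  + by move=> k; exact: lyap12.
  + by move=> y K; exact: (bd_drift b_ge0 p_ge0 d0 bbar_gt0 b_le M_gt0 p_mean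
      alpha eps_gt0 dlow_gt0 d_ge lam_gt0 N0 HN).
  + by rewrite invf_ge1.
  (* Surviving up to 1 + s from 1 implies surviving up to s, and can be achieved by being at y at
     time 1, with probability at least e2, and then surviving for s. *)
  + move=> y s yN s0; rewrite mulrC ler_pdivlMr//.
    have s1 : 0 <= 1 + s by rewrite addr_ge0.
    have h1 : P s 1%N 0%N <= P (1 + s) 1%N 0%N.
      rewrite (addrC 1); apply: le_trans (tf_mul tP 1%N 0%N 0%N s0 ler01).
      by rewrite (bd_absorb tP qP ler01) mulr1.
    have h2 : P (1 + s) 1%N 0%N <= P 1 1%N y * P s y 0%N + (1 - P 1 1%N y).
      rewrite (tf_CK tP)//; apply: (ev_le_term (f := fun k => P s k 0%N)).
        exact: tf_mass.
      by move=> k; exact: P01.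
    have h3 : (1 - P s y 0%N) * e2 <= (1 - P s y 0%N) * P 1 1%N y.
      apply: ler_wpM2l; first by rewrite subr_ge0; case/andP: (P01 s y 0%N s0).
      by apply: le_trans (He2 y yN) _; rewrite mP//; case/andP: yN.
    lra.
  + by move=> s s0; exact: (bd_absorb tP qP).
Qed.

End UniformBounds.

(** * Mass functions and total variation *)

Section MassOfProbability.
Variables (R : realType).

Lemma indic01 (B : set nat) (k : nat) : 0 <= (\1_B k : R) <= 1.
Proof. by rewrite indicE; case: (k \in B); rewrite ?lexx ?ler01. Qed.

Lemma pushforward_mass (disp : measure_display) (T : measurableType disp)
    (Q : probability T R) (f : T -> nat) :
  (forall B, measurable (f @^-1` B)) ->
  let m j := fine (Q (f @^-1` [set j])) in
  mass m /\ forall B : set nat, Q (f @^-1` B) = (ev m \1_B)%:E.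
Proof.
move=> mf m; have mE j : (m j)%:E = Q (f @^-1` [set j]).
  by rewrite fineK// fin_num_measure.
have m0 j : 0 <= m j by rewrite fine_ge0.
have QB (B : set nat) : Q (f @^-1` B) = (\sum_(j <oo) (m j * \1_B j)%:E)%E.
  have -> : f @^-1` B = \bigcup_(j in B) f @^-1` [set j].
    apply/seteqP; split=> [w Bw|w [j Bj /= wj]]; last by rewrite /= wj.
    by exists (f w).
  rewrite measure_bigcup//.
    rewrite eseries_mkcond; apply: eq_eseriesr => j _.
    by rewrite indicE; case: (j \in B); rewrite ?mulr1 ?mulr0// mE.
  by move=> i j _ _ [w [/= wi wj]]; rewrite -wi -wj.
have mm : mass m.
  split => //; rewrite -(@probability_setT _ _ _ Q) -(preimage_setT f) QB.
  by apply: eq_eseriesr => j _; rewrite indicE in_setT mulr1.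
by split=> // B; rewrite QB (evE mm (C := 1))// => k; exact: indic01.
Qed.

Definition pmf_nat (mu : probability nat R) (k : nat) : R := fine (mu [set k]).

Lemma pmf_nat_mass (mu : probability nat R) : mass (pmf_nat mu).
Proof. by have [] := @pushforward_mass _ _ mu id (fun _ => I). Qed.

Lemma pmf_natE (mu : probability nat R) (B : set nat) :
  mu B = (ev (pmf_nat mu) \1_B)%:E.
Proof. by have [_ ->] := @pushforward_mass _ _ mu id (fun _ => I). Qed.

Lemma exists_probability (m : nat -> R) : mass m ->
  exists mu : probability nat R, pmf_nat mu = m.
Proof.
move=> mm; have [m0 m1] := mm.
pose mu : measure nat R := mseries (fun k => mscale (NngNum (m0 k)) (@dirac _ _ k R)) 0.
have muE B : mu B = (ev m \1_B)%:E.
  rewrite (evE mm (C := 1)); last by move=> k; exact: indic01.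
  by apply: eq_eseriesr => k _; rewrite EFinM.
(* [mu] already has total mass 1; normalising it only supplies the structure of a probability. *)
exists (mnormalize mu (@dirac _ _ 0%N R)); apply/funext => k.
have E1 : mu setT = 1%E.
  rewrite muE -[RHS]/(1%:E); congr EFin; rewrite -[RHS](ev_cst 1 mm).
  by congr (ev _ _); apply/funext => j; rewrite indicE in_setT.
rewrite /pmf_nat /= /mnormalize E1 onee_eq0 /= invr1 mule1 muE /=.
rewrite -[RHS](ev_delta _ mm).
by congr (ev _ _); apply/funext => j; rewrite indicE classical_sets.in_set1.
Qed.

Lemma pmf_nat_dirac (x k : nat) : pmf_nat (@dirac _ _ x R) k = (k == x)%:R.
Proof. by rewrite /pmf_nat /= /dirac indicE /= classical_sets.in_set1 eq_sym. Qed.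

Lemma ev_pmf_dirac (x : nat) (f : nat -> R) : (forall k, 0 <= f k <= 1) ->
  ev (pmf_nat (@dirac _ _ x R)) f = f x.
Proof.
move=> f01; have m := pmf_nat_mass (@dirac _ _ x R).
have := ev_ge_term x m f01; have := ev_le_term x m f01.
rewrite !pmf_nat_dirac eqxx mul1r subrr addr0 => le1 le2.
by apply/eqP; rewrite eq_le le1.
Qed.

Lemma sum_indic01 n (E : 'I_n -> set nat) (s : 'I_n -> bool) k :
  trivIset setT E -> 0 <= (\sum_(i < n) (s i)%:R * \1_(E i) k : R) <= 1.
Proof.
move=> tE; have [[i Ei]|nE] := pselect (exists i, E i k); last first.
  rewrite big1 ?lexx ?ler01// => i _; rewrite indicE memNset ?mulr0// => Ei.
  by apply: nE; exists i.
rewrite (bigD1 i)//= big1 ?addr0.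
  by rewrite indicE mem_set// mulr1; case: (s i); rewrite ?lexx ?ler01.
move=> j ji; rewrite indicE memNset ?mulr0// => Ej.
have ij := tE i j I I; have : i = j by apply: ij; exists k.
by move=> e; rewrite e eqxx in ji.
Qed.

Lemma ev_sum_indic (p : nat -> R) n (E : 'I_n -> set nat) (a : 'I_n -> R) :
  mass p -> ev p (fun k => \sum_(i < n) a i * \1_(E i) k) =
  \sum_(i < n) a i * ev p \1_(E i).
Proof.
move=> mp.
have nI (B : set nat) k : `|\1_B k : R| <= 1 by apply: norm01 => j; exact: indic01.
elim: n E a => [|n IH] E a.
  rewrite big_ord0 -[RHS](ev_cst 0 mp); congr (ev _ _); apply/funext => k.
  by rewrite big_ord0.
rewrite big_ord_recr /= -IH.
pose g k : R := \sum_(i < n) a (widen_ord (leqnSn n) i) * \1_(E (widen_ord (leqnSn n) i)) k.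
have ng k : `|g k| <= \sum_(i < n) `|a (widen_ord (leqnSn n) i)|.
  apply: le_trans (ler_norm_sum _ _ _) _; apply: ler_sum => i _.
  by rewrite normrM ler_piMr.
have := ev_lin 1 (a ord_max) mp ng (nI (E ord_max)); rewrite mul1r => <-.
by congr (ev _ _); apply/funext => k; rewrite big_ord_recr /= mul1r.
Qed.

(* Evaluating on the indicator of the union of the cells on which l - m is
   nonnegative, respectively negative, gives the two halves of the norm. *)
Lemma tv_norm_le (l m : nat -> R) (theta : R) (mu : set nat -> \bar R) :
  mass l -> mass m ->
  (forall B, mu B = (ev l \1_B - ev m \1_B)%:E) ->
  (forall f, (forall k, 0 <= f k <= 1) -> `|ev l f - ev m f| <= theta) ->
  (tv_norm mu <= (2 * theta)%:E)%E.
Proof.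
move=> ml mm muE lm; apply: ge_ereal_sup => _ [n [E [_ tE _ ->]]].
pose c i := ev l \1_(E i) - ev m \1_(E i).
have -> : (\sum_(i < n) `|mu (E i)| = (\sum_(i < n) `|c i|)%:E)%E.
  by rewrite -sumEFin; apply: eq_bigr => i _; rewrite muE.
rewrite lee_fin.
pose f (s : 'I_n -> bool) k : R := \sum_(i < n) (s i)%:R * \1_(E i) k.
have fE s : ev l (f s) - ev m (f s) = \sum_(i < n) (s i)%:R * c i.
  rewrite !ev_sum_indic// -sumrB; apply: eq_bigr => i _; rewrite /c; ring.
pose s i := 0 <= c i.
have -> : \sum_(i < n) `|c i| =
    (ev l (f s) - ev m (f s)) - (ev l (f (predC s)) - ev m (f (predC s))).
  rewrite !fE -sumrB; apply: eq_bigr => i _; rewrite /= /s.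
  case: (leP 0 (c i)) => ci /=; rewrite mul0r mul1r ?subr0 ?sub0r.
    by rewrite ger0_norm.
  by rewrite ltr0_norm.
have H s' := lm (f s') (fun k => sum_indic01 s' k tE).
have := H s; have := H (predC s); rewrite !ler_norml; lra.
Qed.

End MassOfProbability.

(** * Conditioned laws of the process *)

Section Process.
Variables (R : realType) (X : nat_process R) (P : R -> nat -> nat -> R).
Variable mu : probability nat R.
Hypothesis tP : transition_function P.
Hypothesis P_absorb : forall t, 0 <= t -> P t 0%N 0%N = 1.
Hypothesis X_cadlag : forall w, cadlag (fun t => np_val X t w).
Hypothesis X_init : forall B : set nat, np_prob X (np_val X 0 @^-1` B) = mu B.
Hypothesis X_markov : Defs.markov P X.

Let Pr := np_prob X.
Let V := np_val X.

Lemma np_preimage_measurable t (B : set nat) : 0 <= t -> measurable (V t @^-1` B).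
Proof.
by move=> t0; have := np_measurable (n := X) t0 measurableT (Y := B) I; rewrite setTI.
Qed.

Lemma markov2 s t (i j : nat) : 0 <= s -> s <= t ->
  Pr (V s @^-1` [set i] `&` V t @^-1` [set j]) =
  (Pr (V s @^-1` [set i]) * (P (t - s) i j)%:E)%E.
Proof.
move=> s0 st.
have := @X_markov 0%N (fun k => if k is 0%N then s else t)
  (fun k => if k is 0%N then i else j) s0.
have mono : forall k, (if k is 0%N then s else t) <= t by case.
move=> /(_ mono) /=; set E1 := \bigcap_(k in _) _; set E2 := \bigcap_(k in _) _.
have -> : E1 = V s @^-1` [set i] `&` V t @^-1` [set j].
  apply/seteqP; split => [w Ew|w [Es Et] [|[|k]]//].
  by split; [exact: (Ew 0%N)|exact: (Ew 1%N)].
have -> // : E2 = V s @^-1` [set i].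
by apply/seteqP; split => [w Ew|w Es [|k]//]; exact: (Ew 0%N).
Qed.

Lemma np_law t : 0 <= t -> let m j := fine (Pr (V t @^-1` [set j])) in
  [/\ mass m, forall B : set nat, Pr (V t @^-1` B) = (ev m \1_B)%:E &
    forall j, m j = ev (pmf_nat mu) (fun i => P t i j)].
Proof.
move=> t0 m; have [mm mE] := pushforward_mass Pr (fun B => np_preimage_measurable B t0).
split=> // j; apply: EFin_inj.
rewrite (evE (pmf_nat_mass mu) (C := 1)); last by move=> k; exact: tf01.
rewrite fineK; last by rewrite fin_num_measure//; exact: np_preimage_measurable.
have -> : V t @^-1` [set j] = \bigcup_i (V 0 @^-1` [set i] `&` V t @^-1` [set j]).
  by apply/seteqP; split => [w wj|w [i _ []]//]; exists (V 0 w).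
rewrite measure_bigcup//.
- rewrite eseries_mkcond; apply: eq_eseriesr => i _; rewrite in_setT.
  transitivity (Pr (V 0 @^-1` [set i] `&` V t @^-1` [set j])) => //.
  rewrite markov2// subr0 EFinM; congr (_ * _)%E.
  by rewrite [LHS]X_init /pmf_nat fineK// fin_num_measure.
- by move=> i _; apply: measurableI; exact: np_preimage_measurable.
- by move=> i k _ _ [w [[/= wi _] [/= wk _]]]; rewrite -wi -wk.
Qed.

Lemma np_absorbed s t : 0 <= s -> s <= t ->
  Pr (V s @^-1` [set 0%N] `&` ~` (V t @^-1` [set 0%N])) = 0%E.
Proof.
move=> s0 st; have t0 := le_trans s0 st.
have m0 r : 0 <= r -> measurable (V r @^-1` [set 0%N]).
  exact: np_preimage_measurable.
have : Pr (V s @^-1` [set 0%N]) =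
    (Pr (V s @^-1` [set 0%N] `\` V t @^-1` [set 0%N]) +
     Pr (V s @^-1` [set 0%N] `&` V t @^-1` [set 0%N]))%E.
  exact: measureDI (m0 s s0) (m0 t t0).
rewrite markov2// P_absorb ?subr_ge0// mule1 setDE.
set x := Pr (V s @^-1` _); set y := Pr (_ `&` _) => xy.
have fx : x \is a fin_num by apply: fin_num_measure; exact: m0.
have fy : y \is a fin_num.
  by apply: fin_num_measure; apply: measurableI; [|apply: measurableC]; exact: m0.
move: xy; rewrite -(fineK fx) -(fineK fy) -EFinD => xy; have H := EFin_inj xy.
by have -> : fine y = 0 by lra.
Qed.

(** For the converse, absence of zeros on [0, t] gives only tau >= t; right-continuity at [t] keeps
    the path off 0 a little longer and makes the inequality strict. *)
Lemma survivalP t w : 0 <= t ->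
  @survival R X t w <-> forall s, 0 <= s <= t -> V s w <> 0%N.
Proof.
move=> t0; rewrite /survival /=; split.
  move=> lt s /andP[s0 st] Vs; move: lt; apply/negP; rewrite -leNgt.
  apply: ge_ereal_inf; exists s%:E; last by rewrite lee_fin.
  by exists s.
move=> H; have [Hr _] := X_cadlag w.
have [e /= e0 He] := Hr t t0.
have t_lt : (t%:E < (t + e)%:E)%E by rewrite lte_fin ltrDl.
apply: lt_le_trans t_lt _; apply: le_ereal_inf_tmp => _ [s [s0 Vs] <-].
rewrite lee_fin leNgt; apply/negP => ste.
have [st|ts] := leP s t; first by apply: (H s _ Vs); rewrite s0.
apply: (H t); first by rewrite t0 lexx.
have <- // : V s w = V t w.
by apply: He => //=; rewrite distrC gtr0_norm ?subr_gt0// ltrBlDl.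
Qed.

(* By right-continuity a path that visits 0 before t and is not at 0 at time t
   is at 0 at some rational time before t. *)
Lemma survivalE t : 0 <= t -> exists N : set (np_space X),
  [/\ measurable N, Pr N = 0%E & @survival R X t = ~` (V t @^-1` [set 0%N]) `\` N].
Proof.
move=> t0.
(* An enumeration of the rationals; integers that code none are sent to 0. *)
pose r (n : nat) : R := ratr (odflt 0 (unpickle n : option rat)).
pose F n := if 0 <= r n <= t
  then V (r n) @^-1` [set 0%N] `&` ~` (V t @^-1` [set 0%N]) else set0.
have mF n : measurable (F n).
  rewrite /F; case: ifPn => // /andP[r0 _].
  by apply: measurableI; [|apply: measurableC]; exact: np_preimage_measurable.
have F0 n : Pr (F n) = 0%E.
  rewrite /F; case: ifPn => [/andP[r0 rt]|_]; last exact: measure0.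
  exact: np_absorbed.
exists (\bigcup_n F n); split.
- exact: bigcup_measurable.
- apply: measure_negligible; first exact: bigcup_measurable.
  apply: negligible_bigcup => n; exists (F n); split => //; exact: F0.
apply/seteqP; split => w.
  move=> /(survivalP _ t0) H; split; first by apply: H; rewrite t0 lexx.
  move=> [n _]; rewrite /F; case: ifPn => // rn [Vr _].
  exact: (H _ rn Vr).
move=> [Vt nF]; apply/(survivalP _ t0) => s /andP[s0 st] Vs.
have {st}st : s < t.
  by rewrite lt_neqAle st andbT; apply/eqP => e; apply: Vt; rewrite -e.
have [Hr _] := X_cadlag w; have [e /= e0 He] := Hr s s0.
have : s < Num.min t (s + e) by rewrite lt_min st ltrDl e0.
move=> /rat_in_itvoo [a]; rewrite in_itv /= lt_min => /andP[sa /andP[at_ ae]].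
apply: nF; exists (pickle a) => //; rewrite /F /r pickleK /=.
rewrite (le_trans s0 (ltW sa)) (ltW at_) /=; split => //=.
rewrite -Vs; apply: He => //=.
by rewrite distrC gtr0_norm ?subr_gt0// ltrBlDl.
Qed.

Lemma cond_lawE t (B : set nat) : 0 <= t ->
  cond_law X t B = (Phi P t (pmf_nat mu) \1_B)%:E.
Proof.
move=> t0; have [mm mE mP] := np_law t0.
have [N [mN N0 sE]] := survivalE t0.
(* Up to the null set [N], surviving with X_t in [C] means that X_t lies in [C] without 0, an event
   at the single time [t]. *)
have key (C : set nat) : Pr (V t @^-1` C `&` @survival R X t) =
    (ev (pmf_nat mu) (killed P t \1_C))%:E.
  pose D := C `\` [set 0%N].
  have mD : measurable (V t @^-1` D) by exact: np_preimage_measurable.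
  have -> : V t @^-1` C `&` @survival R X t = V t @^-1` D `\` N.
    by rewrite sE; apply/seteqP; split => w /=; rewrite /D /setD /=; tauto.
  have DN : Pr (V t @^-1` D `&` N) = 0%E.
    apply/eqP; rewrite eq_le measure_ge0 andbT -N0.
    by apply: le_measure; rewrite ?inE//; exact: measurableI.
  have -> : Pr (V t @^-1` D `\` N) = Pr (V t @^-1` D).
    by apply/esym; rewrite -[RHS]adde0 -DN; exact: measureDI mD mN.
  rewrite mE; congr EFin.
  have [_ mix] := ev_mix (pmf_nat_mass mu) (fun k => tf_mass tP k t0).
  have -> : (fun j => fine (Pr (V t @^-1` [set j]))) =
     (fun j => ev (pmf_nat mu) (fun k => P t k j)) by apply/funext.
  rewrite mix; last by move=> k; exact: indic01.
  congr (ev _ _); apply/funext => x; congr (ev _ _); apply/funext => k.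
  rewrite !indicE /D in_setD classical_sets.in_set1; case: k => [|k] /=.
    by rewrite andbF mul0r.
  by rewrite andbT mul1r.
rewrite /cond_law -/Pr -/V key.
have -> : @survival R X t = V t @^-1` setT `&` @survival R X t.
  by rewrite preimage_setT setTI.
rewrite key /= -EFinM; congr (_ / ev _ (killed P t _))%:E.
by apply/funext => k; rewrite indicE in_setT.
Qed.

End Process.

(** * One transition function per control, and the uniform limit theorem *)

Lemma eq_Phi (R : realType) (P Q : R -> nat -> nat -> R) t :
  (forall x j, P t x j = Q t x j) -> Phi P t = Phi Q t.
Proof.
move=> PQ; have E : P t = Q t by apply/funext => x; apply/funext => j.
by apply/funext => mu; apply/funext => f; rewrite /Phi /killed E.
Qed.

Lemma ereal_inf_gt0 (R : realType) (S : set \bar R) : (0 < ereal_inf S)%E ->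
  exists2 m : R, 0 < m & forall x, S x -> (m%:E <= x)%E.
Proof.
move=> S0; have lbS x : S x -> (ereal_inf S <= x)%E by exact: ereal_inf_lbound.
case: (ereal_inf S) S0 lbS => [m| |] // m0 lbS; first by exists m.
by exists 1 => // x /lbS; apply: le_trans; rewrite leey.
Qed.

Theorem theorem2 (R : realType) (A : topologicalType)
    (b d : nat -> A -> R) (p : nat -> nat -> A -> R)
    (X : (nat -> A) -> probability nat R -> nat_process R) :
  polish R A ->
  (forall n a, 0 <= b n a) ->
  (forall n a, 0 <= d n a) ->
  (forall n k a, (0 < k)%N -> 0 <= p n k a <= 1) ->
  (forall n a, (\sum_(1 <= k <oo) (p n k a)%:E = 1)%E) ->
  (forall a, b 0%N a = 0) ->
  (forall a, d 0%N a = 0) ->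
  (forall alpha mu, is_ctmc (bd_rate b d p alpha) mu (X alpha mu)) ->
  (forall n, borel_fun (b n)) ->
  (forall n, borel_fun (d n)) ->
  (forall n k, (0 < k)%N -> borel_fun (p n k)) ->
  (exists2 bbar : R, 0 < bbar & forall n a, b n a <= bbar * n%:R) ->
  (exists2 dbar : nat -> R, (forall n, 0 <= dbar n) &
     forall n a, d n a <= dbar n) ->
  (exists2 M : R, 0 < M &
     forall n a, (\sum_(1 <= k <oo) (k%:R * p n k a)%:E <= M%:E)%E) ->
  (exists eps dlow : R, [/\ 0 < eps, 0 < dlow &
     forall n a, dlow * (n%:R `^ (1 + eps)) <= d n a]) ->
  (forall y z : nat, (0 < y)%N -> (0 < z)%N ->
     (0 < ereal_inf
            [set np_prob (X alpha \d_y) [set w | np_val (X alpha \d_y) 1 w = z]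
            | alpha in [set: nat -> A]])%E) ->
  exists pi : (nat -> A) -> probability nat R,
    (forall alpha, is_qsd (X alpha) (pi alpha) /\
       forall nu : probability nat R, is_qsd (X alpha) nu ->
         forall B : set nat, nu B = pi alpha B) /\
    exists C gamma : R, [/\ 0 < C, 0 < gamma &
      forall alpha (x : nat), (0 < x)%N -> forall t : R, 0 <= t ->
        (tv_norm (fun B : set nat => cond_law (X alpha \d_x) t B - pi alpha B)
         <= (C * expR (- gamma * t))%:E)%E].
Proof.
move=> _ b_ge0 d_ge0 p01 p_sum1 b0 d0 ctmc _ _ _ [bbar bbar_gt0 b_le]
  [dbar dbar_ge0 d_le] [M M_gt0 p_mean] [eps [dlow [eps_gt0 dlow_gt0 d_ge]]] irr.
have p_ge0 n k a : (0 < k)%N -> 0 <= p n k a by move=> /(p01 n k a) /andP[].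
have unique := bd_unique b_ge0 d_ge0 p_ge0 p_sum1 d0 bbar_gt0 b_le M_gt0 p_mean.
have [P HP] : exists P : (nat -> A) -> R -> nat -> nat -> R, forall alpha,
    [/\ transition_function (P alpha), has_rates (bd_rate b d p alpha) (P alpha) &
     forall mu t B, 0 <= t -> cond_law (X alpha mu) t B =
       (Phi (P alpha) t (pmf_nat mu) \1_B)%:E /\
       np_prob (X alpha mu) (np_val (X alpha mu) t @^-1` B) =
       (ev (fun j => ev (pmf_nat mu) (fun i => P alpha t i j)) \1_B)%:E].
  suff H alpha : exists P : R -> nat -> nat -> R,
    [/\ transition_function P, has_rates (bd_rate b d p alpha) P &
     forall mu t B, 0 <= t -> cond_law (X alpha mu) t B =
       (Phi P t (pmf_nat mu) \1_B)%:E /\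
       np_prob (X alpha mu) (np_val (X alpha mu) t @^-1` B) =
       (ev (fun j => ev (pmf_nat mu) (fun i => P t i j)) \1_B)%:E].
    by have [P HP] := choice H; exists P.
  (* Each initial law brings its own transition function; that of the start at 1 serves as
     reference, and [unique] identifies the others with it. *)
  have [_ _ [P [tP qP _]]] := ctmc alpha (@dirac _ _ 1%N R).
  exists P; split=> // mu t B t0.
  have [cX iX [Q [tQ qQ mQ]]] := ctmc alpha mu.
  have QP x j : Q t x j = P t x j by exact: unique tQ qQ tP qP t x j t0.
  have absQ s : 0 <= s -> Q s 0%N 0%N = 1 by exact: bd_absorb b0 d0 _ _ _ tQ qQ.
  split; first by rewrite (cond_lawE tQ absQ cX iX mQ)// (eq_Phi QP).
  have [_ -> mE] := np_law tQ iX mQ t0; congr (ev _ _)%:E.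
  apply/funext => j; rewrite mE; congr (ev _ _).
  by apply/funext => i; rewrite QP.
(* The positive infimum over controls gives lower bounds that are free of [alpha], as [bd_uniform]
   requires. *)
have [m Hm] : exists m : nat -> nat -> R, forall y z, (0 < y)%N -> (0 < z)%N ->
    0 < m y z /\ forall alpha, m y z <= P alpha 1 y z.
  suff H yz : exists m : R, (0 < yz.1)%N -> (0 < yz.2)%N ->
      0 < m /\ forall alpha, m <= P alpha 1 yz.1 yz.2.
    have [m Hm] := choice H; exists (fun y z => m (y, z)) => y z.
    exact: (Hm (y, z)).
  case: yz => y z /=.
  have [y0|] := boolP (0 < y)%N; last by exists 0.
  have [z0|] := boolP (0 < z)%N; last by exists 0.
  have [m m0 mle] := ereal_inf_gt0 (irr y z y0 z0).
  exists m => _ _; split=> // alpha.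
  have [tP qP Hlaw] := HP alpha.
  have [mm _] := ev_mix (pmf_nat_mass (@dirac _ _ y R)) (fun k => tf_mass tP k ler01).
  have := mle _ (imageP _ (I : [set: nat -> A] alpha)).
  have [_ ->] := Hlaw (@dirac _ _ y R) 1 [set z] ler01.
  rewrite lee_fin; congr (_ <= _).
  transitivity (ev (fun j => ev (pmf_nat (@dirac _ _ y R)) (fun i => P alpha 1 i j))
      (fun k => (k == z)%:R)).
    by congr (ev _ _); apply/funext => k; rewrite indicE classical_sets.in_set1.
  by rewrite (ev_delta _ mm) ev_pmf_dirac// => k; apply: tf01 => //; exact: ler01.
have [t0 [c1 [K [t0_gt0 c1_gt0 K_gt0 HK]]]] := bd_uniform b_ge0 d_ge0 p_ge0 p_sum1
  b0 d0 bbar_gt0 b_le dbar_ge0 d_le M_gt0 p_mean eps_gt0 dlow_gt0 d_ge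
  (fun y z y0 z0 => proj1 (Hm y z y0 z0)).
have Hpi alpha : exists pi : probability nat R, is_qsd (X alpha) pi /\
    (forall nu : probability nat R, is_qsd (X alpha) nu ->
      forall B : set nat, nu B = pi B) /\
    forall x, (0 < x)%N -> forall t, 0 <= t ->
      (tv_norm (fun B : set nat => cond_law (X alpha \d_x) t B - pi B)
       <= (2 * theta t0 c1 K t)%:E)%E.
  have [tP qP Hlaw] := HP alpha.
  have absorb t : 0 <= t -> P alpha t 0%N 0%N = 1 by exact: bd_absorb b0 d0 _ _ _ tP qP.
  have stay t x : 0 <= t -> 0 < P alpha t x x by exact: bd_stay tP qP.
  have [minor surv] := HK alpha (P alpha) tP qP
    (fun y z y0 z0 => proj2 (Hm y z y0 z0) alpha).
  have contract := Phi_contract tP absorb stay t0_gt0 c1_gt0 minor surv.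
  have [m' [mm m0] PhiE] := exists_qsd tP absorb stay t0_gt0 c1_gt0 minor surv.
  have [pi piE] := exists_probability mm.
  exists pi; split; [|split].
  - split; first by rewrite pmf_natE piE (_ : \1__ = fun k => (k == 0%N)%:R);
      [rewrite (ev_delta _ mm) m0|apply/funext => k; rewrite indicE classical_sets.in_set1].
    move=> t t_ge0 B; rewrite (proj1 (Hlaw _ _ _ t_ge0)) [RHS]pmf_natE piE PhiE//.
    by move=> k; exact: indic01.
  - move=> nu [nu0 nuE] B; rewrite !pmf_natE piE; congr EFin.
    have pnu : pmass (pmf_nat nu) by split; [exact: pmf_nat_mass|rewrite /pmf_nat nu0].
    have evnu t : 0 <= t -> Phi (P alpha) t (pmf_nat nu) \1_B = ev (pmf_nat nu) \1_B.
      move=> t_ge0; apply: EFin_inj; rewrite -pmf_natE -(nuE t t_ge0 B).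
      by rewrite (proj1 (Hlaw _ _ _ t_ge0)).
    (* Both laws are fixed by the conditioned evolution, so the contraction over time [n] bounds
       their distance for every [n]. *)
    have diff_le n : `|ev (pmf_nat nu) \1_B - ev m' \1_B| <= theta t0 c1 K n%:R.
      rewrite -(evnu n%:R)// -(PhiE n%:R)//; last by move=> k; exact: indic01.
      by apply: contract => // k; exact: indic01.
    apply/eqP; rewrite -subr_eq0 -normr_le0.
    have th0 := theta_cvg0 tP t0_gt0 c1_gt0 minor surv.
    rewrite -(cvg_lim _ th0)//; apply: limr_ge; first by apply/cvg_ex; exists 0.
    exact: nearW.
  - move=> x x0 t t_ge0.
    have px : pmass (pmf_nat (@dirac _ _ x R)).
      split; first exact: pmf_nat_mass.
      by rewrite pmf_nat_dirac; case: x x0.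
    have [[ml _] lE] := law_pmass tP stay t_ge0 px.
    apply: (tv_norm_le ml mm) => [B|f f01].
      rewrite (proj1 (Hlaw _ _ _ t_ge0)) pmf_natE piE lE//.
      by move=> k; exact: indic01.
    by rewrite lE// -(PhiE t)//; exact: contract.
have [pi Hpi'] := choice Hpi.
exists pi; split; first by move=> alpha; have [? [? _]] := Hpi' alpha.
(* The 2 comes from the normalisation of [tv_norm], the rest from [theta_le]. *)
exists (2 * expR (c1 / K)), (c1 / K / t0); split.
- by rewrite mulr_gt0// expR_gt0.
- by rewrite !divr_gt0.
move=> alpha x x0 t t_ge0; have [_ [_ tv]] := Hpi' alpha.
apply: (le_trans (tv x x0 t t_ge0)); rewrite lee_fin -mulrA ler_wpM2l//.
have [tP qP _] := HP alpha.
have [minor surv] := HK alpha (P alpha) tP qP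
  (fun y z y0 z0 => proj2 (Hm y z y0 z0) alpha).
exact: (theta_le tP t0_gt0 c1_gt0 minor surv t_ge0).
Qed.
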